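(* Let $0<\beta\leq 1/2$ and $0\leq\alpha\leq\beta/2$, and let $k\geq 3$ be an integer. Let $A_1,A_2,\ldots,A_k$ be non-empty subsets of $\mathbb{N}$ such that (1) $a_{1,i}-a_{2,i}=o\big(a_{1,i}^{\beta-\alpha}\big)$ as $i\to+\infty$, where $a_{1,i}$ (resp. $a_{2,i}$) is the $i$-th element of $A_1$ (resp. $A_2$); (2) $A_1(n)-A_2(n)=O(n^{\alpha})$ for all $n\geq 1$; (3) $A_1(n)=\Theta(n^{\beta})$. Then there is no constant $c>0$ for which $$R_{A_1,\ldots,A_k}(n)=cn+o\big(n^{\frac14}\big)\qquad\text{as } n\to\infty .$$
   Context: $\mathbb{N}$ denotes the set of nonnegative integers. For a set $A\subseteq\mathbb{N}$ and $n\in\mathbb{N}$, $A(n)=|\{a\in A: a\leq n\}|$. The elements of a set are listed in increasing order, so the $i$-th element is the $i$-th smallest (conditions (2) and (3) force $A_1$ and $A_2$ to be infinite). For $A_1,\ldots,A_k\subseteq\mathbb{N}$, $R_{A_1,\ldots,A_k}(n)=|\{(a_1,\ldots,a_k): a_1\in A_1,\ldots,a_k\in A_k,\ a_1+\cdots+a_k\leq n\}|$. The notation $f=\Theta(g)$ means that there exist constants $c_1,c_2>0$ such that $c_1g(n)\leq f(n)\leq c_2g(n)$ for all sufficiently large $n$. *)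

(* Defs.v *)
From mathcomp Require Import all_boot all_order all_algebra.
From mathcomp Require Import finmap.
From mathcomp Require Import all_classical all_reals all_analysis.

Set Implicit Arguments.
Unset Strict Implicit.
Unset Printing Implicit Defensive.

Local Open Scope classical_set_scope.

(* [fset_set] returns the empty finite set on infinite arguments; here and in
   [repr_count] it is applied to finite sets only, see [count_upto_finite] and
   [repr_count_finite]. *)
Definition count_upto (A : set nat) (n : nat) : nat :=
  #|` fset_set [set a | A a /\ (a <= n)%N] |%fset.

(* The i-th smallest element of A, with i starting from 1: the element a of A
   such that exactly i elements of A are at most a.  The value is 0 when there
   is no such element (i = 0, or A has fewer than i elements). *)
Definition nth_elt (A : set nat) (i : nat) : nat :=
  xget 0%N [set a | A a /\ count_upto A a = i].

Definition repr_count (k : nat) (A : 'I_k -> set nat) (n : nat) : nat :=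
  #|` fset_set [set a : {ffun 'I_k -> nat} |
        (forall j, A j (a j)) /\ (\sum_(j < k) a j <= n)%N] |%fset.

(* A k-indexed family (A_1, ..., A_k) is a function on 'I_k, so A_1 and A_2
   are its values at the ordinals 0 and 1. *)
Definition idx1 (k : nat) (hk : (3 <= k)%N) : 'I_k := Ordinal (ltnW (ltnW hk)).
Definition idx2 (k : nat) (hk : (3 <= k)%N) : 'I_k := Ordinal (ltnW hk).

Lemma count_upto_finite (A : set nat) (n : nat) :
  finite_set [set a | A a /\ (a <= n)%N].
Proof.
apply: (@sub_finite_set _ _ `I_n.+1); last exact: finite_II.
by move=> a /= [_]; rewrite ltnS.
Qed.

Lemma repr_count_finite (k : nat) (A : 'I_k -> set nat) (n : nat) :
  finite_set [set a : {ffun 'I_k -> nat} |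
    (forall j, A j (a j)) /\ (\sum_(j < k) a j <= n)%N].
Proof.
pose f (b : {ffun 'I_k -> 'I_n.+1}) : {ffun 'I_k -> nat} :=
  [ffun j => nat_of_ord (b j)].
apply: (@sub_finite_set _ _ (f @` setT)).
  move=> a /= [_ ha]; exists [ffun j => inord (a j)] => //.
  apply/ffunP => j; rewrite !ffunE inordK // ltnS.
  by apply: leq_trans ha; rewrite (bigD1 j) //= leq_addr.
exact/finite_image/finite_finset.
Qed.

(* Main.v *)
Require Import Defs.
From mathcomp Require Import all_boot all_order all_algebra finmap.
From mathcomp Require Import all_classical all_reals all_analysis.
From mathcomp Require Import cyclic separable cyclotomic complex ring lra zify.
Import Order.TTheory GRing.Theory Num.Theory.
Import numFieldNormedType.Exports.
Set Implicit Arguments.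
Unset Strict Implicit.
Local Open Scope classical_set_scope.
Local Open Scope ring_scope.

(** Write F1, F2 for the generating functions of the first two sets and G for
    the product of the others.  If the representation function were
    c n + o(n^(1/4)), then F1 F2 G = c/(1 - z) + (1 - z) V, where the
    coefficients of V are o(n^(1/4)).  The contradiction comes from comparing
    means over a circle whose radius is about 1 - 1/N, after multiplication by
    the square of a window S = 1 + z + ... + z^(w - 1) with w of order sqrt N,
    in the tradition of Erdos and Fuchs.

    Since F1 and F2 differ, the square H^2 with H = F1 + F2 is used instead of
    F1 F2, by H^2 G = 4 F1 F2 G + (F1 - F2)^2 G ([abs_HW]).  As in the argument
    of Montgomery and Vaughan, the operator theta = z d/dz is applied first:
    theta (H^2 G) = H W, where H and W have nonnegative coefficients.  The mean
    of |H W S^2| is at least the correlation of H S and W S, and its diagonal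
    part, in which both factors use the same element a <= N of the first set,
    is of order N^(1 + beta) w^(2 - 2 beta) ([dot_lower_bound],
    [sum_elements], [cum_gf_rest_lower]).

    From above there are three contributions ([core_inequality]).
    The pole gives c theta (1/(1 - z)), of mean at most of order w^2 N once
    multiplied by |S|^2; without theta there would be an additional logarithm
    ([abs_theta_geom]).  The part with V is o(N^2) by the Cauchy-Schwarz
    inequality, one of the two windows being spent on |(1 - z) S| <= 2.  The
    part with (F1 - F2)^2 is o(N^2) because the two counting functions satisfy
    sum_{n <= x} (A_1(n) - A_2(n))^2 = o(x^(2 beta)), which is what the
    hypotheses on the first two sets provide together ([sum_sq_diff_le]), and
    because G is at most of order N^(1 - 2 beta) on the circle.

    With w = 2 m and N = (J m)^2 the lower bound is of order
    J^(2 + 2 beta) m^4 and the upper bound of order J^2 m^4, with constants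
    independent of J, which is absurd when J is large ([asymptotic_absurd]).

    Everything is carried out with truncated polynomials and finite means over
    roots of unity, for which the Parseval identity is a finite computation
    ([mean_sq]); the radius is (1 - 1/N)^4 and truncation takes place at N^3,
    where powers of the radius beat every power of N involved. *)

(** * Means over a circle, computed at roots of unity *)

Section Circle.
Variable R : rcfType.
Implicit Types (p q : {poly R}) (z : complex R) (r : R).
Local Notation nm := (@ComplexField.Normc.normc R).
Local Notation toC := (real_complex R).

Definition ev z p : complex R := (map_poly toC p).[z].

(** The Euler operator X d/dX: unlike the derivative it does not shift
    coefficients, so it acts on coefficient sequences as multiplication by n.
    It is locked because its unfolding as a product would otherwise be picked
    up by every rewriting with multiplicativity. *)
Fact theta_key : unit. Proof. exact: tt. Qed.
Definition theta p : {poly R} := locked_with theta_key ('X * p^`()).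
Lemma thetaE p : theta p = 'X * p^`().
Proof. by rewrite /theta unlock. Qed.

(** The mean of p * conj q over the circle of radius r, read on the
    coefficients (see [mean_conj]). *)
Definition dot r p q : R := \sum_(n < size p) p`_n * q`_n * r ^+ (2 * n).

Lemma dot_widen M r p q : (size p <= M)%N ->
  dot r p q = \sum_(n < M) p`_n * q`_n * r ^+ (2 * n).
Proof.
move=> h; rewrite /dot (big_ord_widen M (fun n => p`_n * q`_n * r ^+ (2 * n)) h).
rewrite big_mkcond; apply: eq_bigr => i _; case: ltnP => // hi.
by rewrite nth_default // !mul0r.
Qed.

Lemma evD z p q : ev z (p + q) = ev z p + ev z q.
Proof. by rewrite /ev rmorphD hornerD. Qed.
Lemma evB z p q : ev z (p - q) = ev z p - ev z q.
Proof. by rewrite /ev rmorphB hornerD hornerN. Qed.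
Lemma evM z p q : ev z (p * q) = ev z p * ev z q.
Proof. by rewrite /ev rmorphM hornerM. Qed.
Lemma evC z (a : R) : ev z a%:P = toC a.
Proof. by rewrite /ev map_polyC hornerC. Qed.
Lemma evX z : ev z 'X = z.
Proof. by rewrite /ev map_polyX hornerX. Qed.
Lemma evXn z n : ev z 'X^n = z ^+ n.
Proof. by rewrite /ev map_polyXn hornerXn. Qed.

Lemma ev_wide M z p : (size p <= M)%N ->
  ev z p = \sum_(n < M) toC p`_n * z ^+ n.
Proof.
move=> h; rewrite /ev (@horner_coef_wide _ M) ?size_map_poly //.
by apply: eq_bigr => n _; rewrite coef_map.
Qed.

Lemma nm_toC (a : R) : nm (toC a) = `|a|.
Proof. by rewrite /= expr0n addr0 sqrtr_sqr. Qed.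

Lemma nm_ge0 z : 0 <= nm z. Proof. by case: z => a b /=; exact: sqrtr_ge0. Qed.

Lemma nmM z1 z2 : nm (z1 * z2) = nm z1 * nm z2.
Proof. exact: ComplexField.Normc.normcM. Qed.

Lemma nmX z n : nm (z ^+ n) = nm z ^+ n.
Proof.
elim: n => [|n ih]; first by rewrite !expr0 ComplexField.Normc.normc1.
by rewrite !exprS nmM ih.
Qed.

Lemma nmD z1 z2 : nm (z1 + z2) <= nm z1 + nm z2.
Proof. exact: le_normcD. Qed.

Lemma nmN z : nm (- z) = nm z.
Proof. exact: normcN. Qed.

Lemma nmB z1 z2 : nm (z1 - z2) <= nm z1 + nm z2.
Proof. by rewrite -(nmN z2); exact: nmD. Qed.

Lemma nmE z : `|z| = toC (nm z).
Proof. by case: z. Qed.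

Lemma nm_sum (I : Type) (s : seq I) (f : I -> complex R) :
  nm (\sum_(i <- s) f i) <= \sum_(i <- s) nm (f i).
Proof.
elim/big_rec2 : _ => [|i y x _ h]; first by rewrite ComplexField.Normc.normc0.
by apply: le_trans (nmD _ _) _; rewrite lerD2l.
Qed.

Lemma nm_conj z : nm (conjc z) = nm z.
Proof. by case: z => a b /=; rewrite sqrrN. Qed.

Lemma mul_conj z : conjc z * z = toC (nm z ^+ 2).
Proof. by rewrite mulrC -sqr_normc nmE -rmorphXn. Qed.

(** In an algebraically closed field of characteristic 0 the separable
    polynomial X^n - 1 has n distinct roots, and finite groups of roots of
    unity are cyclic. *)
Lemma prim_root_exists n : (0 < n)%N -> {z : complex R | n.-primitive_root z}.
Proof.
pose p : {poly complex R} := 'X^n - 1.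
have [s Dp] := closed_field_poly_normal p.
move=> n_gt0; apply/sigW; rewrite (monicP _) ?monicXnsubC // scale1r in Dp.
have sn1 : all n.-unity_root s by apply/allP=> z; rewrite -root_prod_XsubC -Dp.
have sz_s : (n < (size s).+1)%N.
  by rewrite -(size_prod_XsubC s id) -Dp size_XnsubC.
have [|z] := hasP (has_prim_root n_gt0 sn1 _ sz_s); last by exists z.
by rewrite -separable_prod_XsubC -Dp separable_Xn_sub_1 // pnatr_eq0 -lt0n.
Qed.

Section Mean.
Variables (M : nat) (w : complex R) (r : R).
Hypothesis wP : M.-primitive_root w.

(** A mean over M-th roots of unity replaces the integral over the circle:
    on polynomials of size at most M the two agree, because distinct exponents
    below M stay distinct modulo M. *)
Definition node (l : nat) : complex R := toC r * w ^+ l.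
Definition mean (f : complex R -> R) : R := M%:R^-1 * \sum_(l < M) f (node l).

Let M_gt0 : (0 < M)%N. Proof. exact: prim_order_gt0 wP. Qed.

Lemma nm_root : nm w = 1.
Proof.
have h : nm w ^+ M = 1.
  by rewrite -nmX (prim_expr_order wP) ComplexField.Normc.normc1.
by apply/eqP; rewrite -(@pexpr_eq1 _ _ M) ?nm_ge0 // h.
Qed.

Lemma nm_node l : 0 <= r -> nm (node l) = r.
Proof. by move=> r0; rewrite /node nmM nmX nm_root expr1n mulr1 nm_toC ger0_norm. Qed.

Lemma root_orthogonal (a b : nat) : (a < M)%N -> (b < M)%N ->
  \sum_(l < M) conjc (w ^+ l) ^+ a * (w ^+ l) ^+ b = (M * (a == b))%:R.
Proof.
move=> ha hb; have wc : conjc w * w = 1 by rewrite mul_conj nm_root expr1n.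
set x := conjc w ^+ a * w ^+ b.
under eq_bigr => l _.
  rewrite rmorphXn /= -!exprM ![(l * _)%N]mulnC !exprM -exprMn -/x.
  over.
have [ab|ab] := eqVneq a b.
  have -> : x = 1 by rewrite /x -ab -exprMn wc expr1n.
  under eq_bigr => l _ do rewrite expr1n.
  by rewrite sumr_const card_ord muln1.
rewrite muln0; have xM : x ^+ M = 1.
  rewrite /x exprMn -!exprM ![(_ * M)%N]mulnC !exprM -rmorphXn.
  by rewrite (prim_expr_order wP) rmorph1 !expr1n mulr1.
have x1 : x - 1 != 0.
  rewrite subr_eq0; apply: contra ab => /eqP h.
  have : w ^+ a * x = w ^+ b.
    by rewrite /x mulrA -exprMn [w * _]mulrC wc expr1n mul1r.
  rewrite h mulr1 => /eqP; rewrite (eq_prim_root_expr wP).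
  by rewrite !modn_small // => /eqP ->.
apply: (mulfI x1); rewrite mulr0.
transitivity (x ^+ M - 1); last by rewrite xM subrr.
by rewrite subrX1; congr (_ * _); apply: eq_bigr.
Qed.

Lemma monomials_at_node (x y : R) a b l :
  conjc (toC x * node l ^+ a) * (toC y * node l ^+ b) =
  toC (x * y * r ^+ (a + b)) * (conjc (w ^+ l) ^+ a * (w ^+ l) ^+ b).
Proof.
have cM (u v : complex R) : conjc (u * v) = conjc u * conjc v by exact: rmorphM.
have cX (u : complex R) n : conjc (u ^+ n) = conjc u ^+ n by exact: rmorphXn.
rewrite /node !(cM, cX) !conjc_real !(rmorphM, rmorphXn) exprD !exprMn.
by rewrite !mulrA; ring.
Qed.

Lemma mean_conj p q : (size p <= M)%N -> (size q <= M)%N ->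
  \sum_(l < M) conjc (ev (node l) p) * ev (node l) q = toC (M%:R * dot r p q).
Proof.
move=> hp hq; rewrite (dot_widen _ _ hp).
under eq_bigr => l _.
  rewrite (ev_wide _ hp) (ev_wide _ hq) rmorph_sum /= big_distrlr /=.
  over.
rewrite exchange_big /= rmorphM rmorph_sum /= mulr_sumr; apply: eq_bigr => a _.
rewrite exchange_big /= (bigD1 a) //= [X in _ + X]big1 ?addr0; last first.
  move=> b ab; transitivity (toC (p`_a * q`_b * r ^+ (a + b)) *
     \sum_(l < M) conjc (w ^+ l) ^+ a * (w ^+ l) ^+ b).
    by rewrite mulr_sumr; apply: eq_bigr => l _; rewrite monomials_at_node.
  rewrite root_orthogonal // eq_sym; have -> : (b == a :> nat) = false.
    exact: negbTE.
  by rewrite muln0 mulr0.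
transitivity (toC (p`_a * q`_a * r ^+ (2 * a)) *
     \sum_(l < M) conjc (w ^+ l) ^+ a * (w ^+ l) ^+ a).
  rewrite mulr_sumr; apply: eq_bigr => l _.
  by rewrite monomials_at_node addnn mul2n.
by rewrite root_orthogonal // eqxx muln1 mulrC rmorph_nat.
Qed.

Lemma mean_sq p : (size p <= M)%N ->
  mean (fun z => nm (ev z p) ^+ 2) = dot r p p.
Proof.
move=> hp; have /complexI h : toC (\sum_(l < M) nm (ev (node l) p) ^+ 2)
    = toC (M%:R * dot r p p).
  rewrite -mean_conj // rmorph_sum; apply: eq_bigr => l _.
  by rewrite mul_conj.
by rewrite /mean h mulKf // pnatr_eq0 -lt0n.
Qed.

(** A lower bound for the mean of a modulus: |p| = |conj p|, and the mean
    of conj p * q is a correlation of coefficients.  When p and q have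
    nonnegative coefficients nothing cancels in it. *)
Lemma dot_le_mean p q : (size p <= M)%N -> (size q <= M)%N ->
  dot r p q <= mean (fun z => nm (ev z p) * nm (ev z q)).
Proof.
move=> hp hq; rewrite /mean ler_pdivlMl ?ltr0n //.
apply: le_trans (ler_norm _) _; rewrite -nm_toC -mean_conj //.
apply: le_trans (nm_sum _ _) _; apply: ler_sum => l _.
by rewrite nmM nm_conj.
Qed.

Lemma mean_le f g : (forall l, f (node l) <= g (node l)) -> mean f <= mean g.
Proof.
by move=> h; rewrite /mean ler_wpM2l ?invr_ge0 ?ler0n //; apply: ler_sum.
Qed.

Lemma meanD f g : mean (fun z => f z + g z) = mean f + mean g.
Proof. by rewrite /mean big_split mulrDr. Qed.

Lemma meanZ (a : R) f : mean (fun z => a * f z) = a * mean f.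
Proof. by rewrite /mean -mulr_sumr mulrCA. Qed.

Lemma mean_cst (a : R) : mean (fun=> a) = a.
Proof.
by rewrite /mean sumr_const card_ord -[a *+ M]mulr_natl mulKf // pnatr_eq0 -lt0n.
Qed.

End Mean.
End Circle.

(** * The Euler operator and the window polynomials *)

Section Theta.
Variable R : rcfType.
Implicit Types (p q : {poly R}).

Lemma thetaD p q : theta (p + q) = theta p + theta q.
Proof. by rewrite !thetaE derivD mulrDr. Qed.
Lemma thetaM p q : theta (p * q) = theta p * q + p * theta q.
Proof. by rewrite !thetaE derivM; ring. Qed.
Lemma coef_theta p n : (theta p)`_n = p`_n *+ n.
Proof. by rewrite !thetaE coefXM coef_deriv; case: n. Qed.
Lemma thetaXn n : theta 'X^n = n%:R%:P * 'X^n :> {poly R}.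
Proof.
apply/polyP => i; rewrite coef_theta coefCM coefXn.
by case: eqP => [->|_]; rewrite ?mulr1 ?mulr0 ?mul0rn.
Qed.
Lemma thetaC (a : R) : theta a%:P = 0.
Proof. by rewrite !thetaE derivC mulr0. Qed.
Lemma thetaX : theta 'X = 'X :> {poly R}.
Proof. by rewrite !thetaE derivX mulr1. Qed.
Lemma theta1 : theta 1 = 0 :> {poly R}.
Proof. exact: thetaC. Qed.
Lemma thetaN p : theta (- p) = - theta p.
Proof. by rewrite !thetaE derivN mulrN. Qed.

(** With n = w this is the window S: multiplication by it replaces a
    coefficient sequence by its sums over w consecutive indices.  With n = L+1
    it is the truncated series of 1/(1 - X). *)
Definition geom n : {poly R} := \poly_(i < n) 1.

Lemma geomE n : geom n = \sum_(i < n) 'X^i.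
Proof. by rewrite /geom poly_def; apply: eq_bigr => i _; rewrite scale1r. Qed.

Lemma geom_tele n : (1 - 'X) * geom n = 1 - 'X^n.
Proof. by rewrite geomE -opprB mulNr -subrX1 opprB. Qed.

Definition nonneg_poly p := forall n, 0 <= p`_n.

End Theta.

Section Pointwise.
Variable R : rcfType.
Implicit Types (p q : {poly R}) (z : complex R) (r : R).
Local Notation nm := (@ComplexField.Normc.normc R).
Variables (z : complex R) (r : R).
Hypotheses (zr : nm z = r) (r1 : r <= 1).
Local Notation ab p := (nm (ev z p)).

Let r0 : 0 <= r. Proof. by rewrite -zr nm_ge0. Qed.

Lemma absM p q : ab (p * q) = ab (p) * ab (q). Proof. by rewrite evM nmM. Qed.
Lemma absD p q : ab (p + q) <= ab (p) + ab (q). Proof. by rewrite evD nmD. Qed.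
Lemma absB p q : ab (p - q) <= ab (p) + ab (q). Proof. by rewrite evB nmB. Qed.
Lemma absC (a : R) : ab (a%:P) = `|a|. Proof. by rewrite evC nm_toC. Qed.
Lemma absXn n : ab ('X^n) = r ^+ n. Proof. by rewrite evXn nmX zr. Qed.
Lemma absX : ab ('X) = r. Proof. by rewrite evX zr. Qed.
Lemma abs_ge0 p : 0 <= ab (p). Proof. exact: nm_ge0. Qed.

Lemma abs_geom n : ab (geom R n) <= n%:R.
Proof.
rewrite geomE (_ : ev z _ = \sum_(i < n) z ^+ i); last first.
  rewrite /ev rmorph_sum /= horner_sum; apply: eq_bigr => i _.
  by rewrite map_polyXn hornerXn.
apply: le_trans (nm_sum _ _) _; rewrite -[X in _ <= X%:R]card_ord -sumr_const.
by apply: ler_sum => i _; rewrite nmX zr exprn_ile1.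
Qed.

(** The window absorbs the factor 1 - z of a sequence of differences, at a
    cost that does not depend on the length of the window. *)
Lemma abs_geom_tele n : ab (1 - 'X) * ab (geom R n) <= 2.
Proof.
rewrite -absM geom_tele; apply: le_trans (absB _ _) _.
rewrite -[X in ab (X)]/(1%:P) absC normr1 absXn -[2]/(1 + 1) lerD2l.
by rewrite exprn_ile1.
Qed.

Lemma abs_le_horner p : nonneg_poly p -> ab (p) <= p.[r].
Proof.
move=> p0; rewrite (@ev_wide _ (size p)) // horner_coef.
apply: le_trans (nm_sum _ _) _; apply: ler_sum => i _.
by rewrite nmM nm_toC nmX zr ger0_norm.
Qed.

Section Abel.
Variables (p U : {poly R}) (b : R) (L w : nat).
Hypothesis pE : p = (1 - 'X) * U + b%:P * 'X^(L.+1).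
Local Notation S := (geom R w).

(** Here U collects partial sums of p, and the last term is the boundary
    term of the summation by parts. *)
Lemma abs_abel : ab (p) * ab (S) <= 2 * ab (U) + `|b| * r ^+ L.+1 * w%:R.
Proof.
rewrite pE; have h := absD ((1 - 'X) * U) (b%:P * 'X^(L.+1)).
rewrite !absM absC absXn in h.
apply: (le_trans (ler_wpM2r (abs_ge0 _) h)); rewrite mulrDl mulrAC.
apply: lerD; first exact/ler_wpM2r/abs_geom_tele/abs_ge0.
by apply: ler_wpM2l (abs_geom _); rewrite mulr_ge0 // exprn_ge0.
Qed.

Lemma abs_theta_abel : ab (theta p) * ab (S) <=
  2 * ab (theta U) + w%:R * ab (U) + L.+1%:R * `|b| * r ^+ L.+1 * w%:R.
Proof.
have -> : theta p = (1 - 'X) * theta U - 'X * U + (L.+1%:R * b)%:P * 'X^(L.+1).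
  rewrite pE thetaD !thetaM thetaD thetaN thetaXn thetaX theta1.
  by rewrite !thetaC polyCM; ring.
have h := absD ((1 - 'X) * theta U - 'X * U) ((L.+1%:R * b)%:P * 'X^(L.+1)).
have h' := absB ((1 - 'X) * theta U) ('X * U).
have {h h'} := le_trans h (lerD h' (lexx _)).
rewrite !absM absC absXn absX normrM normr_nat => h.
apply: (le_trans (ler_wpM2r (abs_ge0 _) h)); rewrite 2!mulrDl.
apply: lerD; last first.
  by apply: ler_wpM2l (abs_geom _); rewrite !mulr_ge0 // exprn_ge0.
apply: lerD; first by rewrite mulrAC; exact/ler_wpM2r/abs_geom_tele/abs_ge0.
rewrite -mulrA [X in _ <= X]mulrC -[X in _ <= X]mul1r ler_pM ?mulr_ge0 ?abs_ge0 //.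
by apply: ler_wpM2l (abs_geom _); exact: abs_ge0.
Qed.
End Abel.

(** Up to boundary terms, theta of 1/(1 - z) has modulus at most
    1/|1 - z|^2.  The mean of |1 - z|^(-2) is exactly computable as a sum of
    squares of coefficients, while the mean of 1/|1 - z| itself would cost a
    logarithm: this is the reason for applying theta before taking moduli.
    The inequality comes from applying theta to (1 - X) E = 1 - X^(L+1)
    and multiplying by E. *)
Lemma abs_theta_geom L : r ^+ L.+1 <= 1 / 2 -> L.+1%:R * r ^+ L.+1 <= 1 ->
  ab (theta (geom R L.+1)) <= 3 * ab (geom R L.+1) ^+ 2 + 1.
Proof.
set E := geom R L.+1 => h1 h2.
have e : (1 - 'X^(L.+1)) * theta E = 'X * (E * E) - L.+1%:R%:P * 'X^(L.+1) * E.
  have := congr1 (fun u => theta u * E) (geom_tele R L.+1); rewrite -/E.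
  rewrite !thetaM !thetaD !thetaN thetaXn thetaX theta1 !add0r => e.
  rewrite -geom_tele -/E -[LHS]subr0 -(subrr (- (L.+1%:R%:P * 'X^(L.+1)) * E)) -{1}e.
  ring.
have := absB ('X * (E * E)) (L.+1%:R%:P * 'X^(L.+1) * E).
rewrite -e !absM absC normr_nat absX absXn => h.
have h3 : 1 / 2 <= ab (1 - 'X^(L.+1)).
  have := absD (1 - 'X^(L.+1)) 'X^(L.+1); rewrite subrK -[X in ab (X)]/(1%:P) absC.
  by rewrite normr1 absXn; lra.
have := abs_ge0 E; have := abs_ge0 (theta E).
set a := ab (theta E) in h *; set x := ab (E) in h *; set y := ab (1 - _) in h h3.
move=> a0 x0.
have : a * (1 / 2) <= y * a by rewrite mulrC; apply: ler_wpM2r.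
have : r * (x * x) <= x * x by rewrite -[X in _ <= X]mul1r ler_wpM2r ?mulr_ge0.
have : L.+1%:R * r ^+ L.+1 * x <= x by rewrite -[X in _ <= X]mul1r ler_wpM2r.
have : 0 <= (x - 1) ^+ 2 by exact: sqr_ge0.
rewrite !expr2; lra.
Qed.

End Pointwise.

(** * Comparison of the two sides of the identity in mean *)

Section Core.
Variable R : rcfType.
Implicit Types (p q : {poly R}) (z : complex R).
Local Notation nm := (@ComplexField.Normc.normc R).

Lemma nonneg_polyD p q : nonneg_poly p -> nonneg_poly q -> nonneg_poly (p + q).
Proof. by move=> hp hq n; rewrite coefD addr_ge0. Qed.
Lemma nonneg_polyM p q : nonneg_poly p -> nonneg_poly q -> nonneg_poly (p * q).
Proof.
by move=> hp hq n; rewrite coefM; apply: sumr_ge0 => i _; rewrite mulr_ge0.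
Qed.
Lemma nonneg_theta p : nonneg_poly p -> nonneg_poly (theta p).
Proof. by move=> hp n; rewrite coef_theta mulrn_wge0. Qed.

Lemma mulr_le_amgm (t a b : R) : 0 < t -> 2 * (a * b) <= t * a ^+ 2 + t^-1 * b ^+ 2.
Proof.
move=> t0; rewrite -subr_ge0.
have -> : t * a ^+ 2 + t^-1 * b ^+ 2 - 2 * (a * b) = t^-1 * (t * a - b) ^+ 2.
  by field; lra.
by rewrite mulr_ge0 ?invr_ge0 ?sqr_ge0 // ltW.
Qed.

Variables (r : R) (F1 F2 G V D : {poly R}) (c v d B t n : R) (L K w : nat).
Hypotheses (r0 : 0 <= r) (r1 : r <= 1) (c0 : 0 <= c) (t0 : 0 < t) (n0 : 0 < n).
Hypothesis G0 : nonneg_poly G.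
Hypothesis QE : F1 * F2 * G =
  c%:P * geom R L.+1 + ((1 - 'X) * V + v%:P * 'X^(L.+1)).
Hypothesis DE : F1 - F2 = (1 - 'X) * D + d%:P * 'X^(K.+1).
Hypotheses (rL1 : r ^+ L.+1 <= 1 / 2) (rL2 : L.+1%:R * r ^+ L.+1 <= 1).
Hypothesis vB : L.+1%:R * `|v| * r ^+ L.+1 <= B.
Hypothesis dB : K.+1%:R * `|d| * r ^+ K.+1 * w%:R <= 1.
Local Notation S := (geom R w).
Local Notation H := (F1 + F2).
Local Notation W := (2%:P * theta H * G + H * theta G).

Section AtPoint.
Variable z : complex R.
Hypothesis zr : nm z = r.
Local Notation ab p := (nm (ev z p)).

(** The terms are those of theta applied to
    c E + (1 - X) V + v X^(L+1).  One window compensates the factor 1 - z in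
    front of theta V, and the product of the other window with theta V is
    split by the inequality between arithmetic and geometric means, with a
    weight t chosen at the very end. *)
Lemma abs_main : ab (theta (F1 * F2 * G)) * ab S ^+ 2 <=
  c * w%:R ^+ 2 * (3 * ab (geom R L.+1) ^+ 2 + 1) + t * ab (theta V) ^+ 2 +
  t^-1 * ab S ^+ 2 + w%:R * (ab V ^+ 2 + ab S ^+ 2) + B * w%:R ^+ 2.
Proof.
have w0 : 0 <= w%:R :> R by exact: ler0n.
have sw : ab S <= w%:R by exact: (abs_geom zr r1).
have s0 : 0 <= ab S by exact: nm_ge0.
pose P := (1 - 'X) * V + v%:P * 'X^(L.+1).
have hP := abs_theta_abel zr r1 w (erefl P).
have hE := abs_theta_geom zr r1 rL1 rL2.
have : ab (theta (F1 * F2 * G)) <= c * ab (theta (geom R L.+1)) + ab (theta P).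
  rewrite QE -/P thetaD thetaM thetaC mul0r add0r.
  by apply: le_trans (absD _ _ _) _; rewrite absM absC ger0_norm.
have e0 : 0 <= ab (theta (geom R L.+1)) by exact: nm_ge0.
have p0 : 0 <= ab (theta P) by exact: nm_ge0.
have v0 : 0 <= ab V by exact: nm_ge0.
have tv0 : 0 <= ab (theta V) by exact: nm_ge0.
set q := ab (theta (F1 * F2 * G)); set e := ab (theta _) in e0 hE *.
set p := ab (theta P) in p0 hP *; set s := ab S in sw s0 hP *.
set x := ab (geom _ L.+1) in hE *.
set a := ab V in v0 hP *; set b := ab (theta V) in tv0 hP *.
move=> hq; have s2 : s ^+ 2 <= w%:R ^+ 2 by rewrite ler_sqr ?nnegrE.
apply: le_trans (ler_wpM2r (sqr_ge0 s) hq) _; rewrite mulrDl.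
have h1 : c * e * s ^+ 2 <= c * w%:R ^+ 2 * (3 * x ^+ 2 + 1).
  have -> : c * e * s ^+ 2 = c * (s ^+ 2 * e) by ring.
  by rewrite -[X in _ <= X]mulrA ler_wpM2l //; apply: ler_pM; rewrite ?sqr_ge0.
have bw : L.+1%:R * `|v| * r ^+ L.+1 * w%:R <= B * w%:R by rewrite ler_wpM2r.
have B0 : 0 <= B by apply: le_trans vB; rewrite !mulr_ge0 // exprn_ge0.
have h2 : p * s ^+ 2 <= 2 * (b * s) + w%:R * (a * s) + B * w%:R ^+ 2.
  rewrite expr2 mulrA; apply: le_trans (ler_wpM2r s0 hP) _.
  rewrite !mulrDl -!mulrA !lerD2l; apply: le_trans (_ : B * w%:R * s <= _).
    by rewrite !mulrA ler_wpM2r.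
  by rewrite -mulrA expr2 !ler_wpM2l.
have h3 := mulr_le_amgm b s t0.
have h4 : w%:R * (a * s) <= w%:R * (a ^+ 2 + s ^+ 2).
  rewrite ler_wpM2l //; have := mulr_le_amgm a s ltr01; rewrite invr1 !mul1r.
  by have := mulr_ge0 v0 s0; lra.
lra.
Qed.

(** Both D and theta D absorb one window each; this is why the square of
    F1 - F2 is harmless although F1 - F2 itself is not small pointwise. *)
Lemma abs_diff :
  ab (theta ((F1 - F2) * (F1 - F2) * G)) * ab S ^+ 2 <=
  G.[r] * (n * (8 * ab D ^+ 2 + 2) +
           n^-1 * (3 * (4 * ab (theta D) ^+ 2 + w%:R ^+ 2 * ab D ^+ 2 + 1))) +
  (theta G).[r] * (8 * ab D ^+ 2 + 2).
Proof.
have kE := DE; set k := F1 - F2 in kE *.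
have w0 : 0 <= w%:R :> R by exact: ler0n.
have h1 := abs_abel zr r1 w kE; have h2 := abs_theta_abel zr r1 w kE.
have hd : `|d| * r ^+ K.+1 * w%:R <= 1.
  apply: le_trans dB; rewrite ler_wpM2r // ler_wpM2r ?exprn_ge0 //.
  by rewrite ler_peMl // ler1n.
have s0 : 0 <= ab S by exact: nm_ge0.
have g1 : ab G <= G.[r] by exact: (abs_le_horner zr).
have g2 : ab (theta G) <= (theta G).[r].
  by apply: (abs_le_horner zr); exact: nonneg_theta.
have -> : theta (k * k * G) = 2%:P * (k * theta k * G) + k * k * theta G.
  by rewrite !thetaM polyCMn; ring.
have := absD z (2%:P * (k * theta k * G)) (k * k * theta G).
rewrite !absM absC ger0_norm // => h.
apply: le_trans (ler_wpM2r (sqr_ge0 _) h) _.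
have k0 : 0 <= ab k by exact: nm_ge0.
have tk0 : 0 <= ab (theta k) by exact: nm_ge0.
have d0 : 0 <= ab D by exact: nm_ge0.
have td0 : 0 <= ab (theta D) by exact: nm_ge0.
have G00 : 0 <= ab G by exact: nm_ge0.
have tG0 : 0 <= ab (theta G) by exact: nm_ge0.
move: {h} h1 h2; set x := ab k in k0 *; set y := ab (theta k) in tk0 *.
set s := ab S in s0 *; set a := ab D in d0 *; set b := ab (theta D) in td0 *.
set g := ab G in G00 g1 *; set g' := ab (theta G) in tG0 g2 *.
move=> h1 h2; have {}h1 : x * s <= 2 * a + 1 by apply: le_trans h1 _; rewrite lerD2l.
have {}h2 : y * s <= 2 * b + w%:R * a + 1.
  by apply: le_trans h2 _; rewrite lerD2l.
have xs : (x * s) ^+ 2 <= 8 * a ^+ 2 + 2.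
  apply: (@le_trans _ _ ((2 * a + 1) ^+ 2)).
    by rewrite ler_sqr ?nnegrE ?mulr_ge0 // addr_ge0 ?mulr_ge0.
  by have := sqr_ge0 (2 * a - 1); rewrite !expr2; lra.
have ys : (y * s) ^+ 2 <= 3 * (4 * b ^+ 2 + w%:R ^+ 2 * a ^+ 2 + 1).
  apply: (@le_trans _ _ ((2 * b + w%:R * a + 1) ^+ 2)).
    by rewrite ler_sqr ?nnegrE ?mulr_ge0 // !addr_ge0 ?mulr_ge0.
  rewrite -exprMn; set u := w%:R * a.
  have := sqr_ge0 (2 * b - u); have := sqr_ge0 (2 * b - 1).
  by have := sqr_ge0 (u - 1); rewrite !expr2; lra.
have xy := mulr_le_amgm (x * s) (y * s) n0.
have n1 : 0 <= n^-1 by rewrite invr_ge0 ltW.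
have e1 : 2 * (x * y * g) * s ^+ 2 <= G.[r] *
   (n * (8 * a ^+ 2 + 2) + n^-1 * (3 * (4 * b ^+ 2 + w%:R ^+ 2 * a ^+ 2 + 1))).
  have -> : 2 * (x * y * g) * s ^+ 2 = g * (2 * (x * s * (y * s))) by ring.
  apply: ler_pM => //; first by rewrite !mulr_ge0.
  by apply: (le_trans xy); apply: lerD; rewrite ler_wpM2l // ltW.
have e2 : x * x * g' * s ^+ 2 <= (theta G).[r] * (8 * a ^+ 2 + 2).
  have -> : x * x * g' * s ^+ 2 = g' * (x * s) ^+ 2 by ring.
  by apply: ler_pM => //; exact: sqr_ge0.
by rewrite mulrDl; exact: lerD.
Qed.

(** The identity behind the whole argument: with H = F1 + F2,
    H^2 G = 4 F1 F2 G + (F1 - F2)^2 G, and theta (H^2 G) = H W where H and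
    W = 2 (theta H) G + H (theta G) have nonnegative coefficients. *)
Lemma abs_HW : ab (H * S) * ab (W * S) <=
  4 * (ab (theta (F1 * F2 * G)) * ab S ^+ 2) +
  ab (theta ((F1 - F2) * (F1 - F2) * G)) * ab S ^+ 2.
Proof.
have -> : ab (H * S) * ab (W * S) = ab (theta (H * H * G)) * ab S ^+ 2.
  have -> : theta (H * H * G) = H * W by rewrite !thetaM polyCMn; ring.
  by rewrite !absM; ring.
rewrite mulrA -mulrDl ler_wpM2r ?sqr_ge0 //.
have -> : H * H * G = 4%:P * (F1 * F2 * G) + (F1 - F2) * (F1 - F2) * G.
  by rewrite polyCMn; ring.
rewrite thetaD [theta (4%:P * _)]thetaM thetaC mul0r add0r.
apply: le_trans (absD _ _ _) _; rewrite lerD2r absM absC.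
by rewrite ger0_norm.
Qed.
End AtPoint.

(** Mean over the circle of the pointwise bounds.  The left-hand side counts
    nearly coinciding elements; the right-hand side involves only sums of
    squares of coefficients and values of G and theta G at r. *)
Lemma core_inequality : dot r (H * S) (W * S) <=
  4 * (c * w%:R ^+ 2 * (3 * dot r (geom R L.+1) (geom R L.+1) + 1) +
       t * dot r (theta V) (theta V) + t^-1 * dot r S S +
       w%:R * (dot r V V + dot r S S) + B * w%:R ^+ 2) +
  (G.[r] * (n * (8 * dot r D D + 2) +
     n^-1 * (3 * (4 * dot r (theta D) (theta D) + w%:R ^+ 2 * dot r D D + 1))) +
  (theta G).[r] * (8 * dot r D D + 2)).
Proof.
have [M [M0 []]] : exists M, [/\ (0 < M)%N,
    [/\ (size (H * S)%R <= M)%N, (size (W * S)%R <= M)%N &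
        (size (geom R L.+1) <= M)%N],
    [/\ (size (theta V) <= M)%N, (size S <= M)%N & (size V <= M)%N],
    (size D <= M)%N & (size (theta D) <= M)%N].
  move: (size _) (size _) (size _) (size _) (size _) (size _) (size _) (size _).
  move=> n1 n2 n3 n4 n5 n6 n7 n8.
  exists (n1 + n2 + n3 + n4 + n5 + n6 + n7 + n8).+1.
  by clear; do !split; lia.
move=> hHS hWS hE [htV hS hV] hD htD; have [om omP] := @prim_root_exists R M M0.
apply: le_trans (dot_le_mean r omP hHS hWS) _.
rewrite -(mean_sq r omP hE) -(mean_sq r omP htV) -(mean_sq r omP hS).
rewrite -(mean_sq r omP hV) -(mean_sq r omP hD) -(mean_sq r omP htD).
pose f z := 4 * (c * w%:R ^+ 2 * (3 * nm (ev z (geom R L.+1)) ^+ 2 + 1) +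
    t * nm (ev z (theta V)) ^+ 2 + t^-1 * nm (ev z S) ^+ 2 +
    w%:R * (nm (ev z V) ^+ 2 + nm (ev z S) ^+ 2) + B * w%:R ^+ 2) +
  (G.[r] * (n * (8 * nm (ev z D) ^+ 2 + 2) +
    n^-1 * (3 * (4 * nm (ev z (theta D)) ^+ 2 +
                 w%:R ^+ 2 * nm (ev z D) ^+ 2 + 1))) +
  (theta G).[r] * (8 * nm (ev z D) ^+ 2 + 2)).
apply: (@le_trans _ _ (mean M om r f)).
  apply: mean_le => l; have zr := nm_node omP l r0.
  apply: le_trans (abs_HW _) _; apply: lerD; last exact: abs_diff.
  by rewrite ler_pM2l //; exact: abs_main.
by rewrite /f !(meanD, meanZ, mean_cst) // lexx.
Qed.
End Core.

(** * Summation by parts, and the diagonal contribution *)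

Section PartialSums.
Variable R : rcfType.
Implicit Types (p q : {poly R}).

Definition cum p n : R := \sum_(i < n.+1) p`_i.

Lemma cumS p n : cum p n.+1 = cum p n + p`_n.+1.
Proof. by rewrite /cum big_ord_recr. Qed.

Lemma cum0 p : cum p 0 = p`_0.
Proof. by rewrite /cum big_ord1. Qed.

Lemma cum_ge0 p n : nonneg_poly p -> 0 <= cum p n.
Proof. by move=> p0; apply: sumr_ge0. Qed.

Lemma cum_homo p n n' : nonneg_poly p -> (n <= n')%N -> cum p n <= cum p n'.
Proof.
move=> p0; elim: n' => [|n' ih]; first by rewrite leqn0 => /eqP ->.
rewrite leq_eqVlt => /predU1P[->//|]; rewrite ltnS => /ih /le_trans; apply.
by rewrite cumS lerDl.
Qed.

Lemma coef1Xmul p n : ((1 - 'X) * p)`_n = p`_n - (if n is n'.+1 then p`_n' else 0).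
Proof. by rewrite mulrBl mul1r coefB coefXM; case: n. Qed.

Lemma abel p L : (size p <= L.+1)%N ->
  p = (1 - 'X) * \poly_(n < L.+1) cum p n + (cum p L)%:P * 'X^(L.+1).
Proof.
move=> hp; apply/polyP => n; rewrite coefD coef1Xmul coefCM coefXn coef_poly.
case: n => [|n]; first by rewrite subr0 mulr0 addr0 cum0.
rewrite /= coef_poly eqSS !ltnS; case: ltngtP => h.
- by rewrite cumS mulr0; ring.
- by rewrite mulr0 nth_default ?(leq_trans hp) ?ltnS ?(ltnW h) // subr0 addr0.
- by rewrite -h nth_default ?(leq_trans hp) ?h // mulr1 sub0r addNr.
Qed.

Lemma horner_cum p L x : (size p <= L.+1)%N ->
  p.[x] = (1 - x) * \sum_(n < L.+1) cum p n * x ^+ n + cum p L * x ^+ L.+1.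
Proof.
move=> hp; rewrite {1}(abel hp) hornerD !hornerM hornerC.
by rewrite hornerD hornerN hornerX hornerC horner_poly hornerXn.
Qed.

(** By summation by parts, since the powers of x decrease. *)
Lemma horner_le_cum p q L x : (size p <= L.+1)%N -> (size q <= L.+1)%N ->
  0 <= x -> x <= 1 -> (forall n, (n <= L)%N -> cum p n <= cum q n) ->
  p.[x] <= q.[x].
Proof.
move=> hp hq x0 x1 h; rewrite (horner_cum x hp) (horner_cum x hq).
apply: lerD; last by rewrite ler_wpM2r ?exprn_ge0 ?h.
rewrite ler_wpM2l ?subr_ge0 //; apply: ler_sum => i _.
by rewrite ler_wpM2r ?exprn_ge0 // h // -ltnS.
Qed.

Lemma cum_le_horner p n x : nonneg_poly p -> 0 <= x -> x <= 1 ->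
  cum p n * x ^+ n <= p.[x].
Proof.
move=> p0 x0 x1; rewrite (@horner_coef_wide _ (maxn (size p) n.+1)) ?leq_maxl //.
rewrite /cum mulr_suml (big_ord_widen (maxn (size p) n.+1)
  (fun i => p`_i * x ^+ n)) ?leq_maxr //.
rewrite big_mkcond; apply: ler_sum => i _; case: ifP => h; last first.
  by rewrite mulr_ge0 ?exprn_ge0.
by rewrite ler_wpM2l // ler_wiXn2l // -ltnS.
Qed.

(** If i + j <= m then i <= m and j <= m. *)
Lemma cumM_le p q m : nonneg_poly p -> nonneg_poly q ->
  cum (p * q) m <= cum p m * cum q m.
Proof.
move=> p0 q0.
have -> : cum (p * q) m = \sum_(i < m.+1) p`_i * cum q (m - i).
  elim: m => [|m ih]; first by rewrite cum0 big_ord1 cum0 coefM big_ord1.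
  rewrite cumS ih coefM [in RHS]big_ord_recr [X in _ + X]big_ord_recr /= addrA.
  rewrite subnn cum0 -big_split /=; congr (_ + _); apply: eq_bigr => i _.
  have im : (i <= m)%N by rewrite -ltnS.
  by rewrite -mulrDr subSn // cumS.
rewrite {2}/cum mulr_suml; apply: ler_sum => i _.
by rewrite ler_wpM2l // cum_homo // leq_subr.
Qed.

Lemma cum_geom L n : (n <= L)%N -> cum (geom R L.+1) n = n.+1%:R.
Proof.
move=> h; rewrite /cum -[in RHS](card_ord n.+1) -sumr_const; apply: eq_bigr => i _.
by rewrite coef_poly (leq_trans (ltn_ord i)).
Qed.

Lemma horner_geom n x : (geom R n).[x] = \sum_(i < n) x ^+ i.
Proof. by rewrite geomE horner_sum; apply: eq_bigr => i _; rewrite hornerXn. Qed.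

Lemma dot_ge0 r p q : nonneg_poly p -> nonneg_poly q -> 0 <= r -> 0 <= dot r p q.
Proof.
by move=> p0 q0 r0; apply: sumr_ge0 => i _; rewrite !mulr_ge0 ?exprn_ge0.
Qed.

Lemma dotDl r p1 p2 q : dot r (p1 + p2) q = dot r p1 q + dot r p2 q.
Proof.
set M := maxn (size (p1 + p2)%R) (maxn (size p1) (size p2)).
rewrite !(@dot_widen _ M) /M ?leq_max ?leqnn ?orbT //.
by rewrite -big_split; apply: eq_bigr => i _; rewrite coefD /= !mulrDl.
Qed.

Lemma dotDr r p q1 q2 : dot r p (q1 + q2) = dot r p q1 + dot r p q2.
Proof.
by rewrite -big_split; apply: eq_bigr => i _; rewrite coefD /= mulrDr mulrDl.
Qed.

Lemma dotZr r p a q : dot r p (a%:P * q) = a * dot r p q.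
Proof.
by rewrite /dot mulr_sumr; apply: eq_bigr => i _; rewrite coefCM mulrCA !mulrA.
Qed.

Lemma dot_sumr r p (I : Type) (s : seq I) (P : pred I) (f : I -> {poly R}) :
  dot r p (\sum_(i <- s | P i) f i) = \sum_(i <- s | P i) dot r p (f i).
Proof.
elim/big_rec2 : _ => [|i y x _ <-]; last exact: dotDr.
by apply: big1 => i _; rewrite coef0 mulr0 mul0r.
Qed.

(** For a + m <= n < a + w the window ending at n contains a, and the same
    window shifted by a contains every exponent up to m. *)
Lemma dot_shifted_window r p q a m w : nonneg_poly p -> nonneg_poly q ->
  0 <= r -> r <= 1 -> (m <= w)%N ->
  p`_a * cum q m * (w - m)%:R * r ^+ (2 * (a + w)) <=
  dot r (p * geom R w) ('X^a * (q * geom R w)).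
Proof.
move=> p0 q0 r0 r1 mw; set P := p * _; set Q := 'X^a * _.
have S0 : nonneg_poly (geom R w) by move=> i; rewrite coef_poly; case: ifP.
have P0 : nonneg_poly P by exact: nonneg_polyM.
have Q0 : nonneg_poly Q.
  by apply: nonneg_polyM (nonneg_polyM _ _) => // i; rewrite coefXn ler0n.
pose f n := P`_n * Q`_n * r ^+ (2 * n).
have f0 n : 0 <= f n by rewrite !mulr_ge0 ?exprn_ge0.
rewrite (@dot_widen _ (maxn (size P) (a + w))) ?leq_maxl //.
rewrite -(big_mkord xpredT f) (@big_cat_nat _ _ _ (a + m)%N) /=; last 2 first.
- exact: leq0n.
- by rewrite leq_max leq_add2l mw orbT.
rewrite [X in _ + X](@big_cat_nat _ _ _ (a + w)%N) /=; last 2 first.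
- by rewrite leq_add2l.
- by rewrite leq_max leqnn orbT.
rewrite addrCA -[X in X <= _]addr0; apply: lerD; last by rewrite addr_ge0 ?sumr_ge0.
have -> : p`_a * cum q m * (w - m)%:R * r ^+ (2 * (a + w)) =
    \sum_(a + m <= n < a + w) p`_a * cum q m * r ^+ (2 * (a + w)).
  by rewrite sumr_const_nat subnDl -[RHS]mulr_natr; ring.
apply: ler_sum_nat => n /andP[h1 h2]; rewrite /f.
have an : (a <= n)%N by apply: leq_trans h1; exact: leq_addr.
have nw : (n - a < w)%N by lia.
apply: ler_pM; rewrite ?mulr_ge0 ?exprn_ge0 ?cum_ge0 //.
  apply: ler_pM; rewrite ?cum_ge0 //.
    rewrite coefM (bigD1 (inord a)) //= inordK ?ltnS // coef_poly nw mulr1.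
    by rewrite lerDl; apply: sumr_ge0 => i _; rewrite mulr_ge0.
  rewrite coefXnM ltnNge an /= coefM; apply: le_trans (@cum_homo q m (n - a) q0 _) _.
    by rewrite leq_subRL.
  rewrite le_eqVlt; apply/orP; left; apply/eqP; apply: eq_bigr => i _.
  by rewrite coef_poly (leq_ltn_trans (leq_subr _ _)) ?mulr1.
by rewrite ler_wiXn2l // leq_mul2l ltnW.
Qed.

(** Only the pairs in which F1 and theta F1 contribute the same exponent
    a <= N are kept; the remaining factor G then contributes its coefficients
    of index at most m. *)
Lemma dot_lower_bound r (F1 F2 G : {poly R}) N m w :
  nonneg_poly F1 -> nonneg_poly F2 -> nonneg_poly G ->
  0 <= r -> r <= 1 -> (m <= w)%N ->
  (\sum_(a < N.+1) a%:R * F1`_a ^+ 2) * cum G m * (w - m)%:R * r ^+ (2 * (N + w))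
  <= dot r ((F1 + F2) * geom R w)
       ((2%:P * theta (F1 + F2) * G + (F1 + F2) * theta G) * geom R w).
Proof.
move=> F10 F20 G0 r0 r1 mw; set S := geom R w.
have S0 : nonneg_poly S by move=> i; rewrite coef_poly; case: ifP.
have -> : (2%:P * theta (F1 + F2) * G + (F1 + F2) * theta G) * S =
   theta F1 * (G * S) +
   (theta F1 * G + theta F2 * G + theta F2 * G + (F1 + F2) * theta G) * S.
  by rewrite thetaD polyCMn; ring.
rewrite mulrDl dotDl !dotDr -!addrA.
apply: (@le_trans _ _ (dot r (F1 * S) (theta F1 * (G * S)))); last first.
  rewrite lerDl !addr_ge0 //; apply: dot_ge0 => //;
  by do ![exact: nonneg_theta | apply: nonneg_polyM | apply: nonneg_polyD | done].
set n := maxn (size (theta F1)) N.+1.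
have -> : theta F1 * (G * S) = \sum_(a < n) ((theta F1)`_a)%:P * ('X^a * (G * S)).
  rewrite -[in LHS](coefK (theta F1)) poly_def mulr_suml.
  rewrite (big_ord_widen n (fun a => ((theta F1)`_a *: 'X^a) * (G * S))) ?leq_maxl //.
  rewrite big_mkcond; apply: eq_bigr => a _; case: ltnP => h.
    by rewrite -mul_polyC mulrA.
  by rewrite nth_default // mul0r.
rewrite dot_sumr.
under [X in _ <= X]eq_bigr => a _ do rewrite dotZr.
rewrite !mulr_suml (big_ord_widen n (fun a : nat => a%:R * F1`_a ^+ 2 * cum G m *
   (w - m)%:R * r ^+ (2 * (N + w)))) ?leq_maxr // big_mkcond.
apply: ler_sum => a _; rewrite coef_theta -[F1`_a *+ a]mulr_natl.
have hd : 0 <= dot r (F1 * S) ('X^a * (G * S)).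
  apply: dot_ge0 => //; do ?apply: nonneg_polyM => //.
  by move=> i; rewrite coefXn ler0n.
case: ifP => h; last by rewrite !mulr_ge0.
have := dot_shifted_window a F10 G0 r0 r1 mw; rewrite -/S => h1.
have := ler_wpM2l (mulr_ge0 (ler0n R a) (F10 a)) h1; apply: le_trans.
rewrite expr2 !mulrA ler_wpM2l ?mulr_ge0 ?cum_ge0 //.
by rewrite ler_wiXn2l // leq_mul2l leq_add2r -ltnS.
Qed.

End PartialSums.

(** * Weighted sums at a radius close to 1 *)

Section Radius.
Variables (R : rcfType) (N s : R).
Implicit Types (p q : {poly R}).
Hypotheses (N1 : 1 <= N) (sE : s = 1 - N^-1).

Let N0 : 0 < N. Proof. exact: lt_le_trans N1. Qed.

Lemma radius_ge0 : 0 <= s.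
Proof. by rewrite sE subr_ge0 invf_le1. Qed.
Let s0 := radius_ge0.

Lemma radius_le1 : s <= 1.
Proof. by rewrite sE gerBl invr_ge0 ltW. Qed.
Let s1 := radius_le1.

Lemma radiusX_ge0 n : 0 <= s ^+ n. Proof. exact: exprn_ge0. Qed.
Let sn0 := radiusX_ge0.

Lemma radiusX_le1 n : s ^+ n <= 1. Proof. exact: exprn_ile1. Qed.
Let sn1 := radiusX_le1.

Lemma sum_radius n : \sum_(i < n) s ^+ i <= N.
Proof.
have e : N^-1 * \sum_(i < n) s ^+ i = 1 - s ^+ n.
  have -> : N^-1 = - (s - 1) by rewrite sE; ring.
  by rewrite mulNr -subrX1 opprB.
rewrite -[X in X <= _](mulVKf (lt0r_neq0 N0)) e -[X in _ <= X]mulr1.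
by rewrite ler_pM2l // gerBl.
Qed.

(** Each of the n terms of the sum of s^i, i < n, is at least s^n. *)
Lemma nat_mul_radius n : n%:R * s ^+ n <= N.
Proof.
apply: le_trans (sum_radius n).
rewrite mulr_natl -[X in _ *+ X]card_ord -sumr_const; apply: ler_sum => i _.
by rewrite ler_wiXn2l // ltnW.
Qed.

Lemma radiusXM k n : (s ^+ k) ^+ n = s ^+ (k * n).
Proof. by rewrite exprM. Qed.

Lemma dot_geom_le n : dot (s ^+ 4) (geom R n) (geom R n) <= N.
Proof.
apply: le_trans (sum_radius n).
rewrite (@dot_widen _ n) ?size_poly //; apply: ler_sum => i _.
rewrite coef_poly ltn_ord !mul1r radiusXM ler_wiXn2l //.
by rewrite mulnA leq_pmull.
Qed.

Lemma dot_geom_le_size n : dot (s ^+ 4) (geom R n) (geom R n) <= n%:R.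
Proof.
rewrite (@dot_widen _ n) ?size_poly // -[X in _ <= X%:R]card_ord -sumr_const.
apply: ler_sum => i _; rewrite coef_poly ltn_ord !mul1r radiusXM.
exact: radiusX_le1.
Qed.

Lemma dot_radius_le p : dot (s ^+ 4) p p <= dot (s ^+ 3) p p.
Proof.
apply: ler_sum => i _; rewrite ler_wpM2l -?expr2 ?sqr_ge0 // !radiusXM.
by rewrite ler_wiXn2l // leq_mul2r orbT.
Qed.

(** The radius is s^4 so that spare powers of s absorb the factors n coming
    from theta, through n s^n <= N; the same device is used below. *)
Lemma dot_theta_le p :
  dot (s ^+ 4) (theta p) (theta p) <= N ^+ 2 * dot (s ^+ 3) p p.
Proof.
rewrite (@dot_widen _ (size p)); last first.
  by apply/leq_sizeP => j hj; rewrite coef_theta nth_default // mul0rn.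
rewrite /dot mulr_sumr; apply: ler_sum => i _; rewrite coef_theta.
have -> : p`_i *+ i * (p`_i *+ i) * (s ^+ 4) ^+ (2 * i) =
    (p`_i * p`_i * (s ^+ 3) ^+ (2 * i)) * (i%:R * s ^+ i) ^+ 2.
  rewrite !radiusXM exprMn -[(s ^+ i) ^+ 2]exprM.
  have -> : (4 * (2 * i) = 3 * (2 * i) + i * 2)%N by lia.
  by rewrite exprD -mulr_natl; ring.
rewrite [X in _ <= X]mulrC ler_wpM2l //.
  by rewrite mulr_ge0 -?expr2 ?sqr_ge0 // radiusXM.
by rewrite ler_sqr ?nnegrE ?mulr_ge0 ?(ltW N0) // nat_mul_radius.
Qed.

Lemma horner_radius_le p : nonneg_poly p -> p.[s ^+ 4] <= p.[s ^+ 3].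
Proof.
move=> p0; rewrite !horner_coef; apply: ler_sum => i _.
by rewrite ler_wpM2l // !radiusXM ler_wiXn2l // leq_mul2r orbT.
Qed.

Lemma horner_theta_le p :
  nonneg_poly p -> (theta p).[s ^+ 4] <= N * p.[s ^+ 3].
Proof.
move=> p0; rewrite (@horner_coef_wide _ (size p)); last first.
  by apply/leq_sizeP => j hj; rewrite coef_theta nth_default // mul0rn.
rewrite horner_coef mulr_sumr; apply: ler_sum => i _; rewrite coef_theta.
have -> : p`_i *+ i * (s ^+ 4) ^+ i = (i%:R * s ^+ i) * (p`_i * (s ^+ 3) ^+ i).
  rewrite !radiusXM (_ : 4 * i = 3 * i + i)%N; last by lia.
  by rewrite exprD -mulr_natl; ring.
by rewrite ler_wpM2r ?nat_mul_radius // mulr_ge0 // radiusXM.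
Qed.

(** Since n s^(2 n) <= N, the factor sqrt n is at most sqrt N after
    multiplication by s^n. *)
Lemma dot_sqrt_bound p (T d K : R) : 0 <= T -> T ^+ 2 = N -> 0 <= d -> 0 <= K ->
  (forall n, p`_n ^+ 2 * s ^+ (4 * n) <= d * Num.sqrt n%:R + K) ->
  dot (s ^+ 3) p p <= (d * T + K) * N.
Proof.
move=> T0 TN d0 K0 h.
apply: (@le_trans _ _ ((d * T + K) * \sum_(i < size p) s ^+ i)); last first.
  by rewrite ler_wpM2l ?sum_radius // addr_ge0 ?mulr_ge0.
rewrite mulr_sumr; apply: ler_sum => i _.
have -> : p`_i * p`_i * (s ^+ 3) ^+ (2 * i) =
    p`_i ^+ 2 * s ^+ (4 * i) * s ^+ i * s ^+ i.
  rewrite radiusXM (_ : 3 * (2 * i) = 4 * i + i + i)%N; last by lia.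
  by rewrite !exprD; ring.
rewrite ler_wpM2r //; apply: le_trans (ler_wpM2r (sn0 _) (h i)) _.
rewrite mulrDl; apply: lerD; last by rewrite -[X in _ <= X]mulr1 ler_wpM2l.
rewrite -mulrA ler_wpM2l // -[X in _ <= X]ger0_norm // -sqrtr_sqr TN.
rewrite -[s ^+ i]ger0_norm // -sqrtr_sqr -sqrtrM ?ler0n // ler_wsqrtr //.
apply: le_trans (nat_mul_radius i); rewrite ler_wpM2l // expr2.
by rewrite -[X in _ <= X]mulr1 ler_wpM2l.
Qed.

(** By summation by parts: (1 - s^2) is at most 2 / N and the remaining sum
    of powers of s is at most N. *)
Lemma dot_partial_sum_bound p L (Z : R) : (size p <= L.+1)%N ->
  (forall n, (n <= L)%N -> (\sum_(i < n.+1) p`_i ^+ 2) * s ^+ n <= Z) ->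
  dot (s ^+ 3) p p <= 3 * Z.
Proof.
move=> hp h.
have Z0 : 0 <= Z.
  apply: le_trans (h 0%N _) => //; rewrite mulr_ge0 // sumr_ge0 // => i _.
  by rewrite sqr_ge0.
pose e : {poly R} := \poly_(i < L.+1) p`_i ^+ 2.
have he n : (n <= L)%N -> cum e n = \sum_(i < n.+1) p`_i ^+ 2.
  move=> hn; apply: eq_bigr => i _.
  by rewrite coef_poly (leq_trans (ltn_ord i)).
apply: (@le_trans _ _ e.[s ^+ 2]).
  rewrite (@dot_widen _ L.+1) // horner_poly; apply: ler_sum => i _.
  rewrite expr2 ler_wpM2l -?expr2 ?sqr_ge0 // !radiusXM ler_wiXn2l //.
  by rewrite mulnA leq_mul2r orbT.
rewrite (@horner_cum _ _ L) ?size_poly //.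
have -> : 3 * Z = 2 * Z + Z by ring.
apply: lerD.
  have -> : 2 * Z = (2 * N^-1) * (Z * N) by field; exact: lt0r_neq0.
  apply: ler_pM.
  - by rewrite subr_ge0 sn1.
  - apply: sumr_ge0 => i _; have iL : (i <= L)%N by rewrite -ltnS.
    rewrite he // radiusXM mulr_ge0 //.
    by apply: sumr_ge0 => j _; rewrite sqr_ge0.
  - have -> : 1 - s ^+ 2 = (1 - s) * (1 + s) by ring.
    have -> : 1 - s = N^-1 by rewrite sE; ring.
    by rewrite mulrC ler_wpM2r ?invr_ge0 ?(ltW N0) //; have := s1; lra.
  - apply: (@le_trans _ _ (Z * \sum_(i < L.+1) s ^+ i)); last first.
      by rewrite ler_wpM2l // sum_radius.
    rewrite mulr_sumr; apply: ler_sum => i _.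
    have iL : (i <= L)%N by rewrite -ltnS.
    by rewrite radiusXM mul2n -addnn exprD mulrA ler_wpM2r // he // h.
rewrite radiusXM he //; apply: le_trans (h L _) => //.
rewrite ler_wpM2l ?ler_wiXn2l //; last by lia.
by apply: sumr_ge0 => j _; rewrite sqr_ge0.
Qed.

Lemma bernoulli n : n%:R <= N -> 1 - n%:R * N^-1 <= s ^+ n.
Proof.
elim: n => [|n ih] hn; first by rewrite expr0 mul0r subr0.
have hn' : n%:R <= N by apply: le_trans hn; rewrite ler_nat.
rewrite exprS; apply: le_trans (ler_wpM2l s0 (ih hn')).
rewrite sE -natr1; have : 0 <= n%:R * N^-1 * N^-1 by rewrite !mulr_ge0 ?invr_ge0 // ltW.
set x := N^-1; lra.
Qed.

End Radius.

(** The inequality of Bernoulli is applied to half of the exponent, where it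
    is not trivial, and the result is squared. *)
Lemma radius_lower_bound (R : rcfType) (n : nat) (s : R) : (2 <= n)%N ->
  s = 1 - n%:R^-1 -> 1 / 8 <= s ^+ n.
Proof.
move=> n2 sE; have n1 : 1 <= n%:R :> R by rewrite ler1n ltnW.
have n0 : 0 < n%:R :> R by exact: lt_le_trans n1.
have h2 : 2 <= n%:R :> R by rewrite (ler_nat _ 2 n).
have hk : (n./2)%:R * 2 <= n%:R :> R.
  by rewrite -natrM ler_nat muln2 -[X in (_ <= X)%N]odd_double_half leq_addl.
have k0 : 0 <= (n./2)%:R :> R by [].
have hb : 1 / 2 <= s ^+ n./2.
  apply: le_trans (bernoulli n1 sE _); last by lra.
  have : (n./2)%:R * n%:R^-1 <= 1 / 2 :> R by rewrite ler_pdivrMr //; lra.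
  lra.
have s2 : 1 / 2 <= s.
  have : n%:R^-1 <= 2^-1 :> R by rewrite lef_pV2 ?posrE.
  by rewrite sE; lra.
have s1 := radius_le1 n1 sE; have s0 := radius_ge0 n1 sE.
apply: (@le_trans _ _ (s ^+ n./2 * s ^+ n./2 * s)).
  have -> : 1 / 8 = 1 / 2 * (1 / 2) * (1 / 2) :> R by field.
  by rewrite !ler_pM // ?mulr_ge0 //; lra.
rewrite -exprD -exprSr ler_wiXn2l // -{1}[n]odd_double_half -addnn.
by case: odd; lia.
Qed.

(** * Counting functions as partial sums of generating polynomials *)

Section Counting.
Implicit Types (A : set nat).

(** This turns the cardinals of classical sets in the definitions of the
    counting functions into cardinals of finite types. *)
Lemma card_fset_set_image (T : finType) (U : choiceType) (f : T -> U) (P : pred T) :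
  injective f ->
  #|` fset_set (f @` [set x | P x]) |%fset = #|[set x | P x]%SET|.
Proof.
move=> fI; rewrite cardsE cardE.
have -> : f @` [set x | P x] = [set` [fset y in [seq f x | x <- enum P]]%fset].
  apply/seteqP; split => y /=; rewrite in_fset.
    by move=> [x Px <-]; apply: map_f; rewrite mem_enum.
  by move=> /mapP[x]; rewrite mem_enum => Px ->; exists x.
by rewrite set_fsetK card_fseq undup_id ?size_map // map_inj_uniq ?enum_uniq.
Qed.

Lemma count_upto_sum A n : count_upto A n = (\sum_(i < n.+1) `[< A i >])%N.
Proof.
rewrite /count_upto.
have -> : [set a | A a /\ (a <= n)%N] =
    (fun i : 'I_n.+1 => i : nat) @` [set i : 'I_n.+1 | `[< A i >]].
  apply/seteqP; split => a /=.
    by move=> [Aa an]; exists (inord a); rewrite ?inordK //; exact/asboolP.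
  by move=> [i /asboolP Ai <-]; split; rewrite // -ltnS.
rewrite card_fset_set_image; last exact: ord_inj.
by rewrite -sum1_card big_mkcond; apply: eq_bigr => i _; rewrite inE; case: asboolP.
Qed.

Lemma count_uptoS A n : count_upto A n.+1 = (count_upto A n + `[< A n.+1 >])%N.
Proof. by rewrite !count_upto_sum big_ord_recr. Qed.

Lemma count_upto_le A m n : (m <= n)%N -> (count_upto A m <= count_upto A n)%N.
Proof.
elim: n => [|n ih]; first by rewrite leqn0 => /eqP ->.
rewrite leq_eqVlt => /predU1P[->//|]; rewrite ltnS => /ih /leq_trans; apply.
by rewrite count_uptoS leq_addr.
Qed.

Lemma count_upto_leS A n : (count_upto A n <= n.+1)%N.
Proof.
rewrite count_upto_sum -[X in (_ <= X)%N]card_ord -sum1_card.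
by apply: leq_sum => i _; case: asboolP.
Qed.

(** The least n for which count_upto A n reaches i is an element of A, and
    the counting function there is exactly i since it jumps by at most 1. *)
Lemma nth_eltP A i n : (0 < i)%N -> (i <= count_upto A n)%N ->
  (nth_elt A i <= n)%N /\ count_upto A (nth_elt A i) = i.
Proof.
move=> i0 hn; have ex : exists m, (i <= count_upto A m)%N by exists n.
case: (ex_minnP ex) => m hm mmin.
have cm : A m /\ count_upto A m = i.
  case: m => [|m] in hm mmin *.
    rewrite count_upto_sum big_ord1 in hm *.
    by case: asboolP hm => [Am|_] /=; rewrite ?leqn0; [split=> //; lia|lia].
  have := mmin m; rewrite count_uptoS in hm *; case: asboolP hm => /= Am hm h.
    by split => //; case: (leqP i (count_upto A m)) => h'; [have := h h'; lia|lia].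
  by rewrite addn0 in hm; have := h hm; lia.
have [Aa ca] : A (nth_elt A i) /\ count_upto A (nth_elt A i) = i.
  by rewrite /nth_elt; case: xgetP => [a _ //|/(_ m) []].
split => //; rewrite leqNgt; apply/negP => h.
have : (count_upto A n < count_upto A (nth_elt A i))%N.
  case: (nth_elt A i) Aa h => // a Aa; rewrite ltnS => na.
  rewrite count_uptoS (asboolT Aa) addn1 ltnS.
  exact: count_upto_le.
by rewrite ca; lia.
Qed.

Lemma le_count_nth_elt A i n : (0 < i)%N -> (exists m, (i <= count_upto A m)%N) ->
  (nth_elt A i <= n)%N -> (i <= count_upto A n)%N.
Proof.
by move=> i0 [m /(nth_eltP i0)[_ e]] h; rewrite -{1}e count_upto_le.
Qed.

Section Poly.
Variable R : rcfType.

Definition setpoly A X : {poly R} := \poly_(i < X.+1) (`[< A i >])%:R.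

Lemma setpoly_nonneg A X : nonneg_poly (setpoly A X).
Proof. by move=> i; rewrite coef_poly; case: ifP. Qed.

Lemma cum_setpoly A X n : (n <= X)%N -> cum (setpoly A X) n = (count_upto A n)%:R.
Proof.
move=> h; rewrite count_upto_sum natr_sum; apply: eq_bigr => i _.
by rewrite coef_poly (leq_trans (ltn_ord i)).
Qed.

Lemma setpoly_sq A X n : (setpoly A X)`_n ^+ 2 = (setpoly A X)`_n.
Proof.
by rewrite coef_poly; case: ifP; rewrite ?expr0n //; case: asboolP; rewrite ?expr1n ?expr0n.
Qed.

Lemma prod_setpoly k (A : 'I_k -> set nat) X :
  \prod_(j < k) setpoly (A j) X =
  \sum_(f : {ffun 'I_k -> 'I_X.+1} | [forall j, `[< A j (f j) >]])
     'X^(\sum_(j < k) f j)%N.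
Proof.
transitivity (\prod_(j < k) \sum_(i < X.+1) (`[< A j i >])%:R *: 'X^i : {poly R}).
  by apply: eq_bigr => j _; rewrite /setpoly poly_def.
rewrite bigA_distr_bigA /= [RHS]big_mkcond; apply: eq_bigr => f _.
case: ifPn => [/forallP h|].
  rewrite -prodrXr; apply: eq_bigr => j _; by rewrite h scale1r.
rewrite negb_forall => /existsP[j hj].
by rewrite (bigD1 j) //= (negbTE hj) scale0r mul0r.
Qed.

Lemma cum_sum (I : Type) (s : seq I) (P : pred I) (F : I -> {poly R}) n :
  cum (\sum_(i <- s | P i) F i) n = \sum_(i <- s | P i) cum (F i) n.
Proof.
by rewrite /cum exchange_big; apply: eq_bigr => i _; rewrite coef_sum.
Qed.

Lemma cum_Xn m n : cum ('X^m : {poly R}) n = (m <= n)%N%:R.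
Proof.
rewrite /cum; under eq_bigr => i _ do rewrite coefXn.
case: leqP => h.
  rewrite (bigD1 (inord m)) //= inordK ?ltnS // eqxx big1 ?addr0 // => i ne.
  move/eqP: ne; case: eqP => // e []; apply: val_inj.
  by rewrite /= inordK ?ltnS.
by rewrite big1 // => i _; case: eqP => // e; have := ltn_ord i; lia.
Qed.

Lemma cum_prod_setpoly k (A : 'I_k -> set nat) X n :
  cum (\prod_(j < k) setpoly (A j) X) n =
  (#|[set f : {ffun 'I_k -> 'I_X.+1} |
       [forall j, `[< A j (f j) >]] && (\sum_(j < k) f j <= n)%N]%SET|)%:R.
Proof.
rewrite prod_setpoly cum_sum -sum1_card natr_sum.
under [LHS]eq_bigr => f _ do rewrite cum_Xn.
rewrite [LHS]big_mkcond [RHS]big_mkcond; apply: eq_bigr => f _.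
by rewrite inE; case: ifP => //= _; case: leqP.
Qed.

Definition ffun_nat k X (f : {ffun 'I_k -> 'I_X.+1}) : {ffun 'I_k -> nat} :=
  [ffun j => f j : nat].

Lemma ffun_nat_inj k X : injective (@ffun_nat k X).
Proof.
by move=> f g /ffunP h; apply/ffunP => j; apply: ord_inj; have := h j; rewrite !ffunE.
Qed.

Lemma cum_prod_le_repr_count k (A : 'I_k -> set nat) X n :
  cum (\prod_(j < k) setpoly (A j) X) n <= (repr_count A n)%:R.
Proof.
rewrite cum_prod_setpoly ler_nat /repr_count -(card_fset_set_image _ (@ffun_nat_inj k X)).
apply: fsubset_leq_card; rewrite -fset_set_sub.
- move=> a /= [f /andP[/forallP fA fn] <-]; split.
    by move=> j; rewrite ffunE; exact/asboolP/fA.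
  by under eq_bigr => j _ do rewrite ffunE.
- by apply: finite_image; exact: finite_finset.
- exact: repr_count_finite.
Qed.

Lemma cum_prod_eq_repr_count k (A : 'I_k -> set nat) X n : (n <= X)%N ->
  cum (\prod_(j < k) setpoly (A j) X) n = (repr_count A n)%:R.
Proof.
move=> nX; rewrite cum_prod_setpoly /repr_count -(card_fset_set_image _ (@ffun_nat_inj k X)).
congr (#|` fset_set _|%fset)%:R; apply/seteqP; split => a /=.
  move=> [f /andP[/forallP fA fn] <-]; split.
    by move=> j; rewrite ffunE; exact/asboolP/fA.
  by under eq_bigr => j _ do rewrite ffunE.
move=> [aA an].
have aX j : (a j < X.+1)%N.
  by rewrite ltnS (leq_trans _ nX) // (leq_trans _ an) // (bigD1 j) //= leq_addr.
exists [ffun j => inord (a j)]; last first.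
  by apply/ffunP => j; rewrite !ffunE inordK.
apply/andP; split; first by apply/forallP => j; rewrite ffunE inordK //; exact/asboolP.
by under eq_bigr => j _ do rewrite ffunE inordK //.
Qed.

End Poly.
End Counting.

(** * The counting functions of the first two sets *)

Section Asymptotics.
Variable R : realType.

Lemma powR_unbounded (b Z : R) : 0 < b ->
  exists n0, forall n, (n0 <= n)%N -> Z <= n%:R `^ b.
Proof.
move=> b0; exists (Num.truncn (`|Z| `^ b^-1)).+1 => n hn.
apply: le_trans (ler_norm Z) _.
have -> : `|Z| = (`|Z| `^ b^-1) `^ b.
  by rewrite -powRrM mulVf ?powRr1 // lt0r_neq0.
apply: ge0_ler_powR; rewrite ?nnegrE ?powR_ge0 ?(ltW b0) //.
apply: ltW; apply: lt_le_trans (truncnS_gt _) _; by rewrite ler_nat.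
Qed.

(** By induction on y; each increment telescopes. *)
Lemma sum_shift_le (mu : nat -> R) y x : (forall n, 0 <= mu n) ->
  (forall n n', (n <= n')%N -> mu n <= mu n') ->
  \sum_(n < x.+1) (mu (n + y)%N - mu n) <= y%:R * mu (x + y)%N.
Proof.
move=> mu0 mu_mono; elim: y => [|y ih].
  by rewrite mul0r big1 // => n _; rewrite addn0 subrr.
have -> : \sum_(n < x.+1) (mu (n + y.+1)%N - mu n) =
    \sum_(n < x.+1) (mu (n + y)%N - mu n) +
    \sum_(n < x.+1) (mu (n.+1 + y)%N - mu (n + y)%N).
  by rewrite -big_split; apply: eq_bigr => n _ /=; rewrite addSnnS; ring.
have -> : \sum_(n < x.+1) (mu (n.+1 + y)%N - mu (n + y)%N) = mu (x.+1 + y)%N - mu y.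
  by rewrite -(big_mkord xpredT (fun n => mu (n.+1 + y)%N - mu (n + y)%N)) telescope_sumr.
rewrite -natr1 mulrDl mul1r addSnnS; apply: lerD.
  by apply: le_trans ih _; rewrite ler_wpM2l // mu_mono // leq_add2l.
by rewrite gerBl.
Qed.

Variables (alpha beta : R) (A1 A2 : set nat).
Hypotheses (b0 : 0 < beta) (b1 : beta <= 1 / 2) (al0 : 0 <= alpha)
  (al1 : alpha <= beta / 2).
Let params := conj (conj b0 b1) (conj al0 al1).
Local Notation N1 n := ((count_upto A1 n)%:R : R).
Local Notation N2 n := ((count_upto A2 n)%:R : R).
Hypothesis close : forall eta : R, 0 < eta -> exists i0, forall i, (i0 <= i)%N ->
  `|(nth_elt A1 i)%:R - (nth_elt A2 i)%:R| <=
    eta * (nth_elt A1 i)%:R `^ (beta - alpha).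
Variable C : R.
Hypothesis diff : forall n, (1 <= n)%N -> `|N1 n - N2 n| <= C * n%:R `^ alpha.
Variables lo hi : R.
Hypotheses (lo0 : 0 < lo) (hi0 : 0 < hi).
Hypothesis lower : exists n0, forall n, (n0 <= n)%N -> lo * n%:R `^ beta <= N1 n.
Hypothesis upper : forall n, (1 <= n)%N -> N1 n <= hi * n%:R `^ beta.

(** Since alpha <= beta / 2 < beta, the difference of the two counting functions
    is of smaller order than n^beta. *)
Lemma count2_lower : exists n0, forall n, (n0 <= n)%N -> lo / 2 * n%:R `^ beta <= N2 n.
Proof.
have [n1 h1] := lower.
have b2 : 0 < beta / 2 by have [[? ?] [? ?]] := params; lra.
have [n2 h2] := @powR_unbounded (beta / 2) (2 * `|C| / lo) b2.
exists (maxn (maxn n1 n2) 1) => n; rewrite !geq_max => /andP[/andP[hn1 hn2] hn].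
have := diff hn; have := h1 _ hn1; have := h2 _ hn2.
have n1R : 1 <= n%:R :> R by rewrite ler1n.
have e : n%:R `^ beta = n%:R `^ (beta / 2) * n%:R `^ (beta / 2) :> R.
  rewrite -powRD -?splitr //; apply/implyP => _; rewrite pnatr_eq0; lia.
rewrite ler_pdivrMr // => hx hl hd.
have ha : `|N1 n - N2 n| <= `|C| * n%:R `^ (beta / 2).
  apply: (le_trans hd); apply: (@le_trans _ _ (`|C| * n%:R `^ alpha)).
    by rewrite ler_wpM2r ?powR_ge0 // ler_norm.
  by rewrite ler_wpM2l // ler_powR.
have x0 : 0 <= n%:R `^ (beta / 2) :> R by exact: powR_ge0.
have : `|C| * n%:R `^ (beta / 2) <= lo / 2 * n%:R `^ beta.
  rewrite e mulrA; apply: ler_wpM2r => //; lra.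
have := ler_norm (N1 n - N2 n); lra.
Qed.

Lemma count1_unbounded i : exists n0, forall n, (n0 <= n)%N -> (i <= count_upto A1 n)%N.
Proof.
have [n1 h1] := lower; have [n2 h2] := @powR_unbounded beta (i%:R / lo) b0.
exists (maxn n1 n2) => n; rewrite geq_max => /andP[hn1 hn2].
rewrite -(ler_nat R); apply: le_trans (h1 _ hn1).
by rewrite mulrC -ler_pdivrMr // h2.
Qed.

Lemma count2_unbounded i : exists n0, forall n, (n0 <= n)%N -> (i <= count_upto A2 n)%N.
Proof.
have [n1 h1] := count2_lower.
have [n2 h2] := @powR_unbounded beta (i%:R / (lo / 2)) b0.
exists (maxn n1 n2) => n; rewrite geq_max => /andP[hn1 hn2].
rewrite -(ler_nat R); apply: le_trans (h1 _ hn1).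
by rewrite mulrC -ler_pdivrMr ?h2 // divr_gt0.
Qed.

(** Elements with the same index differ by at most y, so shifting the argument
    by y is enough for either counting function to catch up with the other.
    The bound on a_{1,i} - a_{2,i} is in terms of a_{1,i}, which may exceed n
    when n bounds a_{2,i}; it is at most 2 x because eta <= 1/2. *)
Lemma count_shift (eta : R) : 0 < eta -> eta <= 1 / 2 ->
  exists n0, forall n x, (n0 <= n)%N -> (n <= x)%N ->
    let y := Num.truncn (eta * (2 * x%:R) `^ (beta - alpha)) in
    (count_upto A1 n <= count_upto A2 (n + y))%N /\
    (count_upto A2 n <= count_upto A1 (n + y))%N.
Proof.
move=> eta0 eta1; have [i0 hi0'] := close eta0.
have [n1 h1] := count1_unbounded (maxn i0 1).
have [n2 h2] := count2_unbounded (maxn i0 1).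
exists (maxn (maxn n1 n2) 1) => n x; rewrite !geq_max => /andP[/andP[hn1 hn2] n0] nx.
set t := eta * _ => /=; set y := Num.truncn t.
have th0 : 0 <= beta - alpha by have [[? ?] [? ?]] := params; lra.
have th1 : beta - alpha <= 1 by have [[? ?] [? ?]] := params; lra.
have near_le (u v : nat) : `|u%:R - v%:R| <= t -> (u <= v + y)%N.
  move=> huv; case: (leqP u v) => [/leq_trans|vu]; first by apply; rewrite leq_addr.
  rewrite -leq_subLR truncn_ge_nat; last first.
    by rewrite /t mulr_ge0 ?powR_ge0 // ltW.
  by rewrite natrB ?(ltnW vu) //; apply: le_trans huv; exact: ler_norm.
have mono (u : nat) : (u <= 2 * x)%N ->
    eta * u%:R `^ (beta - alpha) <= t.
  move=> hu; rewrite ler_pM2l //; apply: ge0_ler_powR; rewrite ?nnegrE ?mulr_ge0 //.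
  by rewrite -natrM ler_nat.
have := h1 _ hn1; have := h2 _ hn2; rewrite !geq_max => /andP[i2 p2] /andP[i1 p1].
split.
- have [k1 k2] := nth_eltP p1 (leqnn _).
  have [m hm] := count2_unbounded (count_upto A1 n).
  apply: le_count_nth_elt => //; first by exists m; exact: hm.
  apply: leq_trans (near_le _ (nth_elt A1 (count_upto A1 n)) _) _; last first.
    by rewrite leq_add2r.
  rewrite distrC; apply: le_trans (hi0' _ i1) (mono _ _).
  by apply: leq_trans k1 (leq_trans nx _); rewrite mul2n -addnn leq_addr.
- have [k1 k2] := nth_eltP p2 (leqnn _).
  have [m hm] := count1_unbounded (count_upto A2 n).
  apply: le_count_nth_elt => //; first by exists m; exact: hm.
  have hd := hi0' _ i2; set u := nth_elt A1 _ in hd *; set v := nth_elt A2 _ in hd k1.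
  have u2x : (u <= 2 * x)%N.
    case: (posnP u) => [->//|u0].
    have hu : u%:R `^ (beta - alpha) <= u%:R :> R.
      by rewrite -[X in _ <= X]powRr1 // ler_powR // ler1n.
    have hv : v%:R <= x%:R :> R by rewrite ler_nat (leq_trans k1).
    rewrite -(ler_nat R) natrM.
    have : eta * u%:R `^ (beta - alpha) <= 1 / 2 * u%:R.
      by apply: ler_pM; rewrite ?powR_ge0 ?(ltW eta0).
    by have := ler_norm (u%:R - v%:R : R); lra.
  apply: leq_trans (near_le _ v _) _; last by rewrite leq_add2r.
  exact: le_trans hd (mono _ _).
Qed.

(** Let mu be the minimum of the two counting functions.  By [count_shift]
    the maximum at n is at most mu (n + y), so the sum of the differences is
    at most y mu (x + y). *)
Lemma sum_diff_le (eta : R) : 0 < eta -> eta <= 1 / 2 -> exists2 K : R, 0 <= K &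
  forall x, (1 <= x)%N -> \sum_(n < x.+1) `|N1 n - N2 n| <=
     K + eta * (2 * x%:R) `^ (beta - alpha) * (hi * (2 * x%:R) `^ beta).
Proof.
move=> eta0 eta1; have [n0 h] := count_shift eta0 eta1.
exists (\sum_(n < n0) `|N1 n - N2 n|); first by apply: sumr_ge0.
move=> x x1; set t := eta * _; pose y := Num.truncn t.
have x1R : 1 <= x%:R :> R by rewrite ler1n.
have t0 : 0 <= t by rewrite mulr_ge0 ?powR_ge0 // ltW.
have yt : y%:R <= t by rewrite truncn_le.
have tx : t <= x%:R.
  have : (2 * x%:R) `^ (beta - alpha) <= 2 * x%:R :> R.
    rewrite -[X in _ <= X]powRr1; last by rewrite mulr_ge0.
    by rewrite ler_powR //; have [[? ?] [? ?]] := params; lra.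
  move=> hp; have : t <= 1 / 2 * (2 * x%:R).
    by apply: ler_pM; rewrite ?powR_ge0 ?(ltW eta0).
  by lra.
pose mu n := Num.min (N1 n) (N2 n).
have mu0 n : 0 <= mu n by rewrite /mu le_min !ler0n.
have mu_mono n n' : (n <= n')%N -> mu n <= mu n'.
  by move=> nn'; rewrite /mu le_min !ge_min !ler_nat !count_upto_le ?orbT.
have hsum := sum_shift_le y x mu0 mu_mono.
have hmu : mu (x + y)%N <= hi * (2 * x%:R) `^ beta.
  rewrite /mu ge_min; apply/orP; left; apply: (@le_trans _ _ (N1 (2 * x)%N)).
    rewrite ler_nat count_upto_le // mul2n -addnn leq_add2l -(ler_nat R).
    exact: le_trans yt tx.
  by rewrite -natrM; apply: upper; rewrite muln_gt0.
have dmu n : (n0 <= n)%N -> (n <= x)%N -> `|N1 n - N2 n| <= mu (n + y)%N - mu n.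
  move=> hn nx; have [h1 h2] := h _ _ hn nx; rewrite -/t -/y in h1 h2.
  have h3 := count_upto_le A1 (leq_addr y n); have h4 := count_upto_le A2 (leq_addr y n).
  have e : `|N1 n - N2 n| = Num.max (N1 n) (N2 n) - mu n.
    rewrite /mu; case: (leP (N1 n) (N2 n)) => h5; last by rewrite ger0_norm ?subr_ge0 ?ltW.
    by rewrite ler0_norm ?subr_le0 // opprB.
  by rewrite e lerD2r /mu le_min !ge_max !ler_nat h1 h2 h3 h4.
apply: (@le_trans _ _ (\sum_(n < n0) `|N1 n - N2 n| +
    \sum_(n < x.+1) (mu (n + y)%N - mu n))); last first.
  rewrite lerD2l; apply: (le_trans hsum); apply: ler_pM => //.
pose f n := `|N1 n - N2 n|; pose g n := mu (n + y)%N - mu n.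
have g0 n : 0 <= g n by rewrite subr_ge0 mu_mono // leq_addr.
have hk k : (k <= x)%N -> \sum_(n < k.+1) f n <= \sum_(n < n0) f n + \sum_(n < k.+1) g n.
  elim: k => [|k ih] hk.
    rewrite !big_ord1; case: (posnP n0) => [e|n0p].
      by rewrite e big_ord0 add0r dmu // e.
    rewrite (bigD1 (Ordinal n0p)) //= -addrA lerDl addr_ge0 //.
    by apply: sumr_ge0 => i _; exact: normr_ge0.
  case: (leqP n0 k.+1) => hn.
    rewrite big_ord_recr [X in _ <= _ + X]big_ord_recr /= addrA.
    by apply: lerD; [apply: ih; exact: ltnW|exact: dmu].
  apply: ler_wpDr; first by apply: sumr_ge0.
  rewrite (big_ord_widen n0 f hn) big_mkcond.
  by apply: ler_sum => i _; case: ifP => // _; exact: normr_ge0.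
exact: hk.
Qed.

(** One factor is bounded by a multiple of x^alpha and the other one
    by [sum_diff_le], where the exponents beta - alpha and beta add up with alpha
    to 2 beta.  This is the only place where the two closeness hypotheses
    are combined. *)
Lemma sum_sq_diff_le (eta : R) : 0 < eta -> exists2 K : R, 0 <= K &
  forall x, \sum_(n < x.+1) (N1 n - N2 n) ^+ 2 <= K + eta * x%:R `^ (2 * beta).
Proof.
move=> eta0; pose Cp := `|C| + 1.
have Cp1 : 1 <= Cp by rewrite /Cp lerDr.
have Cp0 : 0 < Cp by exact: lt_le_trans Cp1.
pose e1 := Num.min (1 / 2) (eta / (4 * Cp * hi)).
have e10 : 0 < e1 by rewrite lt_min !divr_gt0 // !mulr_gt0.
have e1h : e1 <= 1 / 2 by rewrite ge_min lexx.
have e1e : e1 * (4 * Cp * hi) <= eta.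
  by rewrite -ler_pdivlMr ?mulr_gt0 // ge_min lexx orbT.
have [K0 K00 hK] := sum_diff_le e10 e1h; pose Z := Cp * K0.
have D0 : (N1 0 - N2 0) ^+ 2 <= `|N1 0 - N2 0| /\ `|N1 0 - N2 0| <= 1.
  rewrite !count_upto_sum !big_ord1.
  case: asboolP => _; case: asboolP => _ /=;
  by rewrite ?subrr ?subr0 ?sub0r ?normrN ?sqrrN ?expr0n ?expr1n
     ?normr0 ?normr1 ?lexx ?ler01.
exists (eta^-1 * Z ^+ 2 / 2 + 1).
  by rewrite addr_ge0 // divr_ge0 // mulr_ge0 ?sqr_ge0 // invr_ge0 ltW.
move=> x; have he : 0 <= eta^-1 * Z ^+ 2 / 2.
  by rewrite divr_ge0 // mulr_ge0 ?sqr_ge0 // invr_ge0 ltW.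
case: (posnP x) => [->|x1].
  rewrite big_ord1; have [h1 h2] := D0; apply: le_trans h1 (le_trans h2 _).
  by rewrite -addrA; apply: ler_wpDl => //; rewrite lerDl mulr_ge0 ?powR_ge0 // ltW.
have x1R : 1 <= x%:R :> R by rewrite ler1n.
have x0R : 0 < x%:R :> R by exact: lt_le_trans x1R.
have xa1 : 1 <= x%:R `^ alpha :> R by rewrite -[X in X <= _](powRr0 (x%:R : R)) ler_powR.
set u := x%:R `^ beta.
have u2 : x%:R `^ (2 * beta) = u ^+ 2.
  by rewrite mulrC powRrM powR_mulrn // powR_ge0.
have xau : x%:R `^ alpha <= u.
  by rewrite /u ler_powR //; have [[? ?] [? ?]] := params; lra.
have sq n : (n <= x)%N -> (N1 n - N2 n) ^+ 2 <= Cp * x%:R `^ alpha * `|N1 n - N2 n|.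
  move=> nx; case: (posnP n) => [->|n1].
    have [h1 h2] := D0; apply: (le_trans h1); rewrite ler_peMl //.
    by apply: mulr_ege1.
  rewrite -real_normK ?num_real // expr2 ler_wpM2r //.
  apply: le_trans (diff n1) _; apply: ler_pM; rewrite ?powR_ge0 //.
  - have := diff n1; have : 0 < n%:R `^ alpha :> R by rewrite powR_gt0 // ltr0n.
    move=> p h; have := le_trans (normr_ge0 _) h; by rewrite pmulr_lge0.
  - by rewrite /Cp; have := ler_norm C; lra.
  - by apply: ge0_ler_powR; rewrite ?nnegrE // ler_nat.
apply: (@le_trans _ _ (Cp * x%:R `^ alpha * \sum_(n < x.+1) `|N1 n - N2 n|)).
  by rewrite mulr_sumr; apply: ler_sum => n _; apply: sq; rewrite -ltnS.
have cx0 : 0 <= Cp * x%:R `^ alpha by rewrite mulr_ge0 ?powR_ge0 // ltW.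
apply: le_trans (ler_wpM2l cx0 (hK x x1)) _; rewrite mulrDr.
(* The constant K0 comes multiplied by x^alpha <= u; as u = x^beta and
   u^2 = x^(2 beta), it is absorbed into a new constant. *)
have t1 : Cp * x%:R `^ alpha * K0 <= eta^-1 * Z ^+ 2 / 2 + eta / 2 * u ^+ 2.
  have h := mulr_le_amgm u Z eta0.
  have : Cp * x%:R `^ alpha * K0 <= u * Z.
    by rewrite /Z mulrAC [X in _ <= X]mulrC ler_wpM2l // mulr_ge0 // ltW.
  by lra.
have t2 : Cp * x%:R `^ alpha * (e1 * (2 * x%:R) `^ (beta - alpha) *
     (hi * (2 * x%:R) `^ beta)) <= eta / 2 * u ^+ 2.
  have h2x : x%:R `^ alpha <= (2 * x%:R) `^ alpha :> R.
    by apply: ge0_ler_powR; rewrite ?nnegrE ?mulr_ge0 //; lra.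
  have e : (2 * x%:R) `^ alpha * (2 * x%:R) `^ (beta - alpha) * (2 * x%:R) `^ beta
      = (2 * x%:R) `^ (2 * beta) :> R.
    have nz : 2 * x%:R != 0 :> R by rewrite mulf_neq0 // lt0r_neq0.
    rewrite -powRD ?nz ?implybT // -powRD ?nz ?implybT //.
    by congr (_ `^ _); ring.
  have h2 : (2 * x%:R) `^ (2 * beta) <= 2 * u ^+ 2.
    rewrite powRM // ?u2; apply: ler_wpM2r; first exact: sqr_ge0.
    rewrite -[X in _ <= X]powRr1 // ler_powR ?ler1n //.
    by have [[? ?] [? ?]] := params; lra.
  have -> : Cp * x%:R `^ alpha * (e1 * (2 * x%:R) `^ (beta - alpha) *
     (hi * (2 * x%:R) `^ beta)) = (e1 * Cp * hi) * (x%:R `^ alpha *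
       ((2 * x%:R) `^ (beta - alpha) * (2 * x%:R) `^ beta)) by ring.
  have p0 : 0 <= e1 * Cp * hi by rewrite !mulr_ge0 // ltW.
  apply: (@le_trans _ _ ((e1 * Cp * hi) * (2 * u ^+ 2))).
    rewrite ler_wpM2l //; apply: le_trans h2; rewrite -e -[X in _ <= X]mulrA.
    by apply: ler_wpM2r => //; apply: mulr_ge0; exact: powR_ge0.
  have := ler_wpM2r (sqr_ge0 u) e1e; lra.
rewrite u2; apply: le_trans (lerD t1 t2) _; lra.
Qed.
End Asymptotics.

(** * The generating polynomials at scale N *)

Section Scale.
Variables (R : realType) (alpha beta : R) (k : nat) (hk : (3 <= k)%N).
Variable A : 'I_k -> set nat.
Local Notation A1 := (A (idx1 hk)).
Local Notation A2 := (A (idx2 hk)).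
Hypotheses (b0 : 0 < beta) (b1 : beta <= 1 / 2) (al0 : 0 <= alpha)
  (al1 : alpha <= beta / 2).
Hypothesis close : forall eta : R, 0 < eta -> exists i0, forall i, (i0 <= i)%N ->
  `|(nth_elt A1 i)%:R - (nth_elt A2 i)%:R| <=
    eta * (nth_elt A1 i)%:R `^ (beta - alpha).
Variable C : R.
Hypothesis diff : forall n, (1 <= n)%N ->
  `|(count_upto A1 n)%:R - (count_upto A2 n)%:R : R| <= C * n%:R `^ alpha.
Variables lo hi : R.
Hypotheses (lo0 : 0 < lo) (hi0 : 0 < hi).
Hypothesis lower : exists n0, forall n, (n0 <= n)%N ->
  lo * n%:R `^ beta <= (count_upto A1 n)%:R.
Hypothesis upper : forall n, (1 <= n)%N -> (count_upto A1 n)%:R <= hi * n%:R `^ beta.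
Variable c : R.
Hypothesis c0 : 0 < c.
Hypothesis asym : forall eps : R, 0 < eps -> exists n0, forall n, (n0 <= n)%N ->
  `|(repr_count A n)%:R - c * n%:R| <= eps * n%:R `^ (1 / 4).

Lemma count2_upper n : (1 <= n)%N -> (count_upto A2 n)%:R <= (hi + `|C|) * n%:R `^ beta.
Proof.
move=> n1; have := diff n1; have := upper n1; rewrite mulrDl.
have n1R : 1 <= n%:R :> R by rewrite ler1n.
have ab : alpha <= beta by have := (b0, al1) => -[? ?]; lra.
have : C * n%:R `^ alpha <= `|C| * n%:R `^ beta.
  by apply: le_trans (ler_wpM2r (powR_ge0 _ _) (ler_norm C)) _; rewrite ler_wpM2l ?ler_powR.
have := ler_norm (- ((count_upto A1 n)%:R - (count_upto A2 n)%:R : R)).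
rewrite normrN; lra.
Qed.

Lemma repr_count_bound : exists2 B : R, 0 <= B &
  forall n, (repr_count A n)%:R <= B * n.+1%:R.
Proof.
have [n0 h] := asym ltr01; pose S := \sum_(i < n0) (repr_count A i)%:R : R.
have S0 : 0 <= S by apply: sumr_ge0.
have c0' := c0; exists (c + 1 + S) => [|n]; first by lra.
have nR : n.+1%:R = n%:R + 1 :> R by rewrite natr1.
have n0R : 0 <= n%:R :> R by [].
case: (leqP n0 n) => hn.
  have q : n%:R `^ (1 / 4) <= n%:R + 1 :> R.
    case: (posnP n) => [->|n1]; first by rewrite powR0 ?add0r //; lra.
    apply: (@le_trans _ _ (n%:R `^ 1)); last by rewrite powRr1 //; lra.
    by rewrite ler_powR ?ler1n //; lra.
  have := h _ hn; have := ler_norm ((repr_count A n)%:R - c * n%:R : R).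
  have := mulr_ge0 S0 n0R; rewrite nR; nra.
have : (repr_count A n)%:R <= S.
  by rewrite /S (bigD1 (Ordinal hn)) //= lerDl; apply: sumr_ge0.
have := mulr_ge0 S0 n0R; have := mulr_ge0 (ltW c0') n0R; rewrite nR; nra.
Qed.

Lemma repr_count_error (eps : R) : 0 < eps -> exists2 K : R, 0 <= K &
  forall n, `|(repr_count A n)%:R - c * n.+1%:R| <= eps * n%:R `^ (1 / 4) + K.
Proof.
move=> e0; have [n0 h] := asym e0.
pose S := \sum_(i < n0) `|(repr_count A i)%:R - c * i%:R| : R.
have S0 : 0 <= S by apply: sumr_ge0.
have c0' := c0; exists (c + S) => [|n]; first by lra.
have -> : (repr_count A n)%:R - c * n.+1%:R = ((repr_count A n)%:R - c * n%:R) - c.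
  by rewrite -natr1; ring.
apply: le_trans (ler_normB _ _) _; rewrite (gtr0_norm c0).
have p0 : 0 <= eps * n%:R `^ (1 / 4) by rewrite mulr_ge0 ?powR_ge0 // ltW.
case: (leqP n0 n) => hn; first by have := h _ hn; lra.
have : `|(repr_count A n)%:R - c * n%:R| <= S.
  by rewrite /S (bigD1 (Ordinal hn)) //= lerDl; apply: sumr_ge0 => i _; exact: normr_ge0.
lra.
Qed.

(** The elements up to n / K, for K large and fixed, are at most half of the
    elements up to n; each of the others is at least n / K. *)
Lemma sum_elements : exists2 kap : R, 0 < kap & exists n0, forall n, (n0 <= n)%N ->
  kap * (n%:R * n%:R `^ beta) <= \sum_(a < n.+1) a%:R * (`[< A1 a >])%:R.
Proof.
have [K0 hK0] := @powR_unbounded R beta (2 * hi / lo) b0.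
pose K := maxn K0 1; have K1 : (0 < K)%N by rewrite leq_max orbT.
have K0R : 0 < K%:R :> R by rewrite ltr0n.
have hK : 2 * hi / lo <= K%:R `^ beta by apply: hK0; rewrite leq_maxl.
have [n1 h1] := lower.
exists (lo / 2 / K%:R); first by rewrite !divr_gt0.
exists (maxn n1 K) => n; rewrite geq_max => /andP[hn1 hnK].
pose N0 := (n %/ K)%N; have N01 : (1 <= N0)%N by rewrite divn_gt0.
have N0n : (N0 <= n)%N by exact: leq_div.
have c1 : (count_upto A1 N0)%:R <= lo / 2 * n%:R `^ beta.
  apply: le_trans (upper N01) _.
  have hN0 : N0%:R <= n%:R / K%:R :> R.
    by rewrite ler_pdivlMr // -natrM ler_nat leq_trunc_div.
  have : N0%:R `^ beta <= (n%:R / K%:R) `^ beta.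
    by apply: ge0_ler_powR; rewrite ?nnegrE ?divr_ge0 // ltW.
  rewrite powRM ?invr_ge0 // -powR_inv1 // -powRrM mulN1r powRN => h.
  apply: le_trans (ler_wpM2l (ltW hi0) h) _.
  rewrite mulrCA mulrC ler_wpM2r ?powR_ge0 // ler_pdivrMr ?powR_gt0 //.
  move: hK; rewrite ler_pdivrMr //; lra.
have hs : \sum_(a < n.+1) (n%:R / K%:R) * ((N0 < a)%N && `[< A1 a >])%:R <=
    \sum_(a < n.+1) a%:R * (`[< A1 a >])%:R :> R.
  apply: ler_sum => a _; case: ltnP => /= ha; last by rewrite mulr0 mulr_ge0.
  rewrite ler_wpM2r // ler_pdivrMr // -natrM ler_nat.
  by apply: leq_trans (ltnW (ltn_ceil n K1)) _; rewrite leq_mul2r ha orbT.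
apply: le_trans hs; rewrite -mulr_sumr.
have e : (count_upto A1 n)%:R = (count_upto A1 N0)%:R +
    \sum_(a < n.+1) ((N0 < a)%N && `[< A1 a >])%:R :> R.
  rewrite !count_upto_sum !natr_sum.
  rewrite (big_ord_widen n.+1 (fun a => (`[< A1 a >])%:R : R) (N0n : N0 < n.+1)%N).
  rewrite [X in _ = X + _]big_mkcond -big_split; apply: eq_bigr => a _ /=.
  by rewrite ltnS; case: leqP; rewrite /= ?addr0 ?add0r.
have := h1 _ hn1; rewrite e => h2.
set S := \sum_(a < n.+1) _ in h2 *.
have -> : lo / 2 / K%:R * (n%:R * n%:R `^ beta) = n%:R / K%:R * (lo / 2 * n%:R `^ beta).
  by field; rewrite lt0r_neq0.
rewrite ler_wpM2l ?divr_ge0 //; lra.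
Qed.

Section Polys.
Variable N : nat.
(** The sets are truncated at N^3: beyond that point powers of the radius are
    smaller than any power of N that occurs, so the wrong coefficients of the
    truncated product and the boundary terms are negligible. *)
Definition cutoff := (N ^ 3)%N.
Definition deg_bound := (k * cutoff)%N.
Definition gf1 : {poly R} := setpoly R A1 cutoff.
Definition gf2 : {poly R} := setpoly R A2 cutoff.
Definition gf_rest : {poly R} :=
  \prod_(j < k | (j != idx1 hk) && (j != idx2 hk)) setpoly R (A j) cutoff.
Definition gf_all : {poly R} := \prod_(j < k) setpoly R (A j) cutoff.
Definition gf_err : {poly R} := gf_all - c%:P * geom R deg_bound.+1.
Definition err_sums : {poly R} := \poly_(n < deg_bound.+1) cum gf_err n.
Definition diff_sums : {poly R} := \poly_(n < cutoff.+1) cum (gf1 - gf2) n.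
Definition radius : R := 1 - N%:R^-1.

Lemma gf_all_split : gf1 * gf2 * gf_rest = gf_all.
Proof.
by rewrite /gf_all (bigD1 (idx1 hk)) //= (bigD1 (idx2 hk)) //= mulrA.
Qed.

Lemma gf_rest_nonneg : nonneg_poly gf_rest.
Proof.
rewrite /gf_rest; elim/big_rec: _ => [i|j p _ hp]; first by rewrite coef1 ler0n.
exact: nonneg_polyM (setpoly_nonneg _ _ _) hp.
Qed.

Lemma gf_all_nonneg : nonneg_poly gf_all.
Proof.
rewrite -gf_all_split; do 2?apply: nonneg_polyM; try exact: setpoly_nonneg.
exact: gf_rest_nonneg.
Qed.

Lemma size_gf_all : (size gf_all <= deg_bound.+1)%N.
Proof.
apply: leq_trans (size_poly_prod_leq _ _) _; rewrite cardT size_enum_ord.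
rewrite leq_subLR addnS ltnS /deg_bound -mulnS -[X in (X * _)%N]card_ord -sum_nat_const.
by apply: leq_sum => j _; exact: size_poly.
Qed.

Lemma size_gf_err : (size gf_err <= deg_bound.+1)%N.
Proof.
apply: leq_trans (size_polyD _ _) _; rewrite geq_max size_gf_all size_polyN /=.
by rewrite mul_polyC; apply: leq_trans (size_scale_leq _ _) _; exact: size_poly.
Qed.

Lemma size_gf_diff : (size (gf1 - gf2)%R <= cutoff.+1)%N.
Proof.
by apply: leq_trans (size_polyD _ _) _; rewrite geq_max size_polyN !size_poly.
Qed.

Lemma cum_gf_err n : (n <= deg_bound)%N -> cum gf_err n = cum gf_all n - c * n.+1%:R.
Proof.
move=> hn; rewrite -(cum_geom R hn) /cum mulr_sumr -sumrB; apply: eq_bigr => i _.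
by rewrite coefB coefCM.
Qed.

Lemma cum_gf_diff n : (n <= cutoff)%N ->
  cum (gf1 - gf2) n = (count_upto A1 n)%:R - (count_upto A2 n)%:R.
Proof.
move=> hn; rewrite -!(cum_setpoly R _ hn) /cum -sumrB.
by apply: eq_bigr => i _; rewrite coefB.
Qed.

Lemma gf_all_abel : gf1 * gf2 * gf_rest = c%:P * geom R deg_bound.+1 +
  ((1 - 'X) * err_sums + (cum gf_err deg_bound)%:P * 'X^(deg_bound.+1)).
Proof. by rewrite gf_all_split -(abel size_gf_err) /gf_err addrCA subrr addr0. Qed.

Lemma gf_diff_abel : gf1 - gf2 =
  (1 - 'X) * diff_sums + (cum (gf1 - gf2) cutoff)%:P * 'X^(cutoff.+1).
Proof. exact: abel size_gf_diff. Qed.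

Section Radius.
Hypothesis N2 : (2 <= N)%N.
Let Nr : R := N%:R.
Let s := radius.
Let Nr2 : 2 <= Nr. Proof. by rewrite /Nr (ler_nat _ 2 N). Qed.
Let Nr1 : 1 <= Nr. Proof. by rewrite /Nr ler1n ltnW. Qed.
Let Nr0 : 0 < Nr. Proof. exact: lt_le_trans Nr1. Qed.
Let sE : s = 1 - Nr^-1. Proof. by []. Qed.
Let s0 := radius_ge0 Nr1 sE.
Let s1 := radius_le1 Nr1 sE.

Lemma radius_tail n : (cutoff <= n)%N -> s ^+ n <= Nr^-1 ^+ 2.
Proof.
move=> hn; have h := nat_mul_radius Nr1 sE n.
have n3 : Nr ^+ 3 <= n%:R by rewrite /Nr -natrX ler_nat.
have N3 : 0 < Nr ^+ 3 by rewrite exprn_gt0.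
rewrite -(ler_pM2l N3); apply: (@le_trans _ _ (n%:R * s ^+ n)).
  by rewrite ler_wpM2r // exprn_ge0.
by apply: (le_trans h); rewrite exprSr -mulrA mulrCA -exprMn mulfV ?lt0r_neq0 // expr1n mulr1.
Qed.

(** Two factors s^n absorb n^2, the other two are at most N^(-2) each. *)
Lemma sq_radius_tail n : (cutoff <= n)%N -> n%:R ^+ 2 * s ^+ 4 ^+ n <= Nr^-1 ^+ 2.
Proof.
move=> hn; have h := nat_mul_radius Nr1 sE n; have ht := radius_tail hn.
have sn0 : 0 <= s ^+ n by rewrite exprn_ge0.
have -> : n%:R ^+ 2 * s ^+ 4 ^+ n = (n%:R * s ^+ n) ^+ 2 * (s ^+ n) ^+ 2.
  by rewrite -exprM mulnC exprM; ring.
have -> : Nr^-1 ^+ 2 = Nr ^+ 2 * (Nr^-1 ^+ 2) ^+ 2 by field; rewrite lt0r_neq0.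
have i0 : 0 <= Nr^-1 ^+ 2 by exact: sqr_ge0.
have Nr0' := ltW Nr0.
apply: ler_pM; rewrite ?sqr_ge0 //; last by rewrite ler_sqr.
by rewrite ler_sqr ?nnegrE ?mulr_ge0.
Qed.

Lemma cutoff_le_deg : (cutoff <= deg_bound)%N.
Proof. by rewrite /deg_bound leq_pmull // (leq_trans _ hk). Qed.

Lemma inv_sq_le : Nr^-1 ^+ 2 <= 1 / 4.
Proof.
have : Nr^-1 <= 2^-1 by rewrite lef_pV2 ?posrE.
have : 0 <= Nr^-1 by rewrite invr_ge0 ltW.
rewrite expr2; nra.
Qed.

Lemma cum_gf_all_le n : cum gf_all n <= (repr_count A n)%:R.
Proof. exact: cum_prod_le_repr_count. Qed.

Lemma cum_gf_all_eq n : (n <= cutoff)%N -> cum gf_all n = (repr_count A n)%:R.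
Proof. exact: cum_prod_eq_repr_count. Qed.

Lemma cum_gf_err_le (B : R) : 0 <= B ->
  (forall n, (repr_count A n)%:R <= B * n.+1%:R) ->
  forall n, (n <= deg_bound)%N -> `|cum gf_err n| <= (B + c) * n.+1%:R.
Proof.
move=> B0 hB n hn; rewrite cum_gf_err //; apply: le_trans (ler_normB _ _) _.
rewrite mulrDl ger0_norm ?cum_ge0 //; last exact: gf_all_nonneg.
rewrite ger0_norm ?mulr_ge0 ?(ltW c0) // lerD2r.
exact: le_trans (cum_gf_all_le n) (hB n).
Qed.

(** Up to the cutoff the coefficients are those of the error term of the
    asymptotic formula; beyond it the linear bound of [cum_gf_err_le] and the
    decay of the radius suffice. *)
Lemma err_sums_bound (e K B : R) : 0 <= B -> 0 <= e -> 0 <= K ->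
  (forall n, (repr_count A n)%:R <= B * n.+1%:R) ->
  (forall n, `|(repr_count A n)%:R - c * n.+1%:R| <= e * n%:R `^ (1 / 4) + K) ->
  dot (s ^+ 3) err_sums err_sums <=
    (2 * e ^+ 2 * Num.sqrt Nr + (2 * K ^+ 2 + 4 * (B + c) ^+ 2)) * Nr.
Proof.
move=> B0 e0 K0 hB hK.
have K'0 : 0 <= 2 * K ^+ 2 + 4 * (B + c) ^+ 2.
  by rewrite addr_ge0 // mulr_ge0 ?sqr_ge0.
apply: (dot_sqrt_bound Nr1 sE); rewrite ?sqrtr_ge0 ?sqr_sqrtr ?(ltW Nr0) //.
  by rewrite mulr_ge0 ?sqr_ge0.
move=> n; have q0 : 0 <= 2 * e ^+ 2 * Num.sqrt n%:R.
  by rewrite !mulr_ge0 ?sqr_ge0 ?sqrtr_ge0.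
rewrite coef_poly; case: ltnP => hn; last first.
  by rewrite expr0n mul0r addr_ge0.
rewrite ltnS in hn; case: (leqP n cutoff) => hc.
  have := hK n; rewrite -cum_gf_all_eq // -cum_gf_err //; set x := cum _ _.
  have ee : (n%:R `^ (1 / 4)) ^+ 2 = Num.sqrt n%:R :> R.
    rewrite -powR_mulrn ?powR_ge0 // -powRrM (_ : 1 / 4 * 2%:R = 2^-1); last by field.
    by rewrite powR12_sqrt.
  have p0 : 0 <= e * n%:R `^ (1 / 4) by rewrite mulr_ge0 ?powR_ge0.
  move=> hx; have x2 : x ^+ 2 <= 2 * e ^+ 2 * Num.sqrt n%:R + 2 * K ^+ 2.
    rewrite -real_normK ?num_real //.
    apply: (@le_trans _ _ ((e * n%:R `^ (1 / 4) + K) ^+ 2)).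
      by rewrite ler_sqr ?nnegrE ?addr_ge0.
    rewrite -ee -[2 * e ^+ 2 * _]mulrA -exprMn.
    by have := sqr_ge0 (e * n%:R `^ (1 / 4) - K); rewrite !expr2; lra.
  apply: (@le_trans _ _ (x ^+ 2)).
    by rewrite ler_piMr ?sqr_ge0 // exprn_ile1.
  apply: (le_trans x2); rewrite addrA lerDl mulr_ge0 ?sqr_ge0 //.
have := cum_gf_err_le B0 hB hn; set x := cum _ _ => hx.
apply: ler_wpDl => //; apply: ler_wpDl; first by rewrite mulr_ge0 ?sqr_ge0.
have n1 : (1 <= n)%N by apply: leq_ltn_trans hc.
have hx2 : `|x| <= 2 * (B + c) * n%:R.
  apply: (le_trans hx); rewrite [2 * _]mulrC -mulrA ler_wpM2l //.
    by rewrite addr_ge0 // ltW.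
  by rewrite -natrM ler_nat mul2n -addnn -addn1 leq_add2l.
rewrite -real_normK ?num_real //.
have bc : 0 <= B + c by rewrite addr_ge0 // ltW.
apply: (@le_trans _ _ ((2 * (B + c) * n%:R) ^+ 2 * s ^+ (4 * n))).
  rewrite ler_wpM2r ?exprn_ge0 // ler_sqr ?nnegrE ?mulr_ge0 //.
rewrite exprMn -mulrA exprM.
have := sq_radius_tail (ltnW hc); have := inv_sq_le => h1 h2.
have -> : (2 * (B + c)) ^+ 2 = 4 * (B + c) ^+ 2 by ring.
rewrite ler_piMr ?mulr_ge0 ?sqr_ge0 //; lra.
Qed.

(** For n > N the growth of n^(2 beta) is at most linear in n / N, as
    2 beta <= 1, and is absorbed by s^n. *)
Lemma diff_sums_bound (eta K : R) : 0 <= eta -> 0 <= K ->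
  (forall x, \sum_(n < x.+1) ((count_upto A1 n)%:R - (count_upto A2 n)%:R) ^+ 2
     <= K + eta * x%:R `^ (2 * beta)) ->
  dot (s ^+ 3) diff_sums diff_sums <= 3 * (K + eta * Nr `^ (2 * beta)).
Proof.
move=> eta0 K0 h; apply: (@dot_partial_sum_bound _ _ _ Nr1 sE _ cutoff).
  exact: size_poly.
move=> n hn; have sn1 := radiusX_le1 Nr1 sE n.
have sn0 : 0 <= s ^+ n by exact: exprn_ge0.
have -> : \sum_(i < n.+1) diff_sums`_i ^+ 2 =
    \sum_(i < n.+1) ((count_upto A1 i)%:R - (count_upto A2 i)%:R) ^+ 2.
  apply: eq_bigr => i _; have hi' : (i <= cutoff)%N.
    by apply: leq_trans hn; rewrite -ltnS.
  by rewrite coef_poly ltnS hi' cum_gf_diff.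
apply: le_trans (ler_wpM2r sn0 (h n)) _; rewrite mulrDl; apply: lerD.
  by rewrite ler_piMr.
rewrite -mulrA ler_wpM2l //; have bb : 0 <= 2 * beta by rewrite mulr_ge0 // ltW.
have b2 : 2 * beta <= 1 by have b1' := b1; lra.
case: (leP n%:R Nr) => hnN.
  apply: (@le_trans _ _ (n%:R `^ (2 * beta))); first by rewrite ler_piMr // powR_ge0.
  by apply: ge0_ler_powR; rewrite ?nnegrE // ltW.
have -> : n%:R `^ (2 * beta) = Nr `^ (2 * beta) * (n%:R / Nr) `^ (2 * beta).
  rewrite -powRM ?divr_ge0 // ?(ltW Nr0) //; congr (_ `^ _).
  by field; rewrite lt0r_neq0.
rewrite -mulrA ler_piMr ?powR_ge0 //.
have hq : 1 <= n%:R / Nr by rewrite ler_pdivlMr // mul1r ltW.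
have : (n%:R / Nr) `^ (2 * beta) <= n%:R / Nr.
  by rewrite -[X in _ <= X]powRr1 ?ler_powR // (le_trans _ hq).
move=> hp; apply: le_trans (ler_wpM2r sn0 hp) _.
rewrite mulrAC ler_pdivrMr // mul1r; exact: nat_mul_radius.
Qed.

(** The product F1 F2 G is at most a multiple of N at this radius, whereas F1
    and F2 are at least multiples of N^beta. *)
Lemma gf_rest_bound (B : R) (lo1 lo2 : R) : 0 <= B -> 0 < lo1 -> 0 < lo2 ->
  (forall n, (repr_count A n)%:R <= B * n.+1%:R) ->
  lo1 * Nr `^ beta <= (count_upto A1 N)%:R ->
  lo2 * Nr `^ beta <= (count_upto A2 N)%:R ->
  gf_rest.[s ^+ 3] <= B * 8 ^+ 6 / (lo1 * lo2) * (Nr / Nr `^ (2 * beta)).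
Proof.
move=> B0 l1 l2 hB h1 h2; set x := s ^+ 3.
have x0 : 0 <= x by exact: exprn_ge0.
have x1 : x <= 1 by exact: exprn_ile1.
have hQ : gf_all.[x] <= B * Nr.
  apply: (@le_trans _ _ (B%:P * geom R deg_bound.+1).[x]).
    apply: (@horner_le_cum _ _ _ deg_bound) => //; first exact: size_gf_all.
      by rewrite mul_polyC; apply: leq_trans (size_scale_leq _ _) _; exact: size_poly.
    move=> n hn; apply: le_trans (cum_gf_all_le n) (le_trans (hB n) _).
    by rewrite -(cum_geom R hn) /cum mulr_sumr; apply: ler_sum => i _; rewrite coefCM.
  rewrite hornerM hornerC ler_wpM2l // horner_geom.
  apply: le_trans (sum_radius Nr1 sE deg_bound.+1); apply: ler_sum => i _.
  by rewrite /x -exprM ler_wiXn2l // leq_pmull.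
have NX : (N <= cutoff)%N by rewrite /cutoff -{1}[N]expn1 leq_exp2l.
have low (A0 : set nat) l : 0 < l -> l * Nr `^ beta <= (count_upto A0 N)%:R ->
    (8^-1) ^+ 3 * (l * Nr `^ beta) <= (setpoly R A0 cutoff).[x].
  move=> l0 hl; apply: le_trans (cum_le_horner N (setpoly_nonneg _ _ _) x0 x1).
  rewrite cum_setpoly // mulrC; apply: ler_pM => //.
    by rewrite mulr_ge0 ?powR_ge0 // ltW.
  rewrite /x -exprM mulnC exprM ler_pXn2r ?nnegrE ?exprn_ge0 //.
  by have := radius_lower_bound N2 (erefl s); rewrite div1r.
have q1 := low _ _ l1 h1; have q2 := low _ _ l2 h2.
have p0 : 0 < Nr `^ beta by rewrite powR_gt0.
have g0 : 0 <= gf_rest.[x].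
  by rewrite horner_coef; apply: sumr_ge0 => i _; rewrite mulr_ge0 ?exprn_ge0 ?gf_rest_nonneg.
have p2 : Nr `^ (2 * beta) = Nr `^ beta ^+ 2.
  by rewrite mulrC powRrM powR_mulrn // powR_ge0.
have u1 : 0 < 8^-1 ^+ 3 * (lo1 * Nr `^ beta) by rewrite mulr_gt0 ?exprn_gt0 ?mulr_gt0.
have u2 : 0 < 8^-1 ^+ 3 * (lo2 * Nr `^ beta) by rewrite mulr_gt0 ?exprn_gt0 ?mulr_gt0.
have : (8^-1 ^+ 3 * (lo1 * Nr `^ beta)) * (8^-1 ^+ 3 * (lo2 * Nr `^ beta)) * gf_rest.[x]
    <= B * Nr.
  apply: le_trans hQ; rewrite -gf_all_split 2!hornerM ler_wpM2r //.
  by apply: ler_pM => //; exact: ltW.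
rewrite mulrC -ler_pdivlMr ?mulr_gt0 // p2 => h; apply: (le_trans h).
rewrite le_eqVlt; apply/orP; left; apply/eqP; field.
by rewrite !lt0r_neq0.
Qed.

Lemma cum_gf_rest_lower m : (m <= cutoff)%N ->
  (repr_count A m)%:R <=
    (count_upto A1 m)%:R * (count_upto A2 m)%:R * cum gf_rest m.
Proof.
move=> hm; rewrite -cum_gf_all_eq // -gf_all_split.
have n1 := setpoly_nonneg R A1 cutoff; have n2 := setpoly_nonneg R A2 cutoff.
apply: le_trans (cumM_le _ (nonneg_polyM n1 n2) gf_rest_nonneg) _.
rewrite ler_wpM2r ?cum_ge0 //; first exact: gf_rest_nonneg.
by rewrite -!(cum_setpoly R _ hm); exact: cumM_le.
Qed.

(** [core_inequality] with the window 2 m and [dot_lower_bound], in terms of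
    bounds for the three sums of squares.  The last term collects the
    contribution of (F1 - F2)^2 G. *)
Lemma scale_inequality (m : nat) (t B vv Y g : R) : (2 * m <= N)%N -> 0 < t ->
  0 <= B -> (forall n, (repr_count A n)%:R <= B * n.+1%:R) ->
  dot (s ^+ 3) err_sums err_sums <= vv -> dot (s ^+ 3) diff_sums diff_sums <= Y ->
  gf_rest.[s ^+ 3] <= g ->
  (\sum_(a < N.+1) a%:R * (`[< A1 a >])%:R) * cum gf_rest m * m%:R * (8^-1) ^+ 16 <=
  4 * (c * (2 * m%:R) ^+ 2 * (3 * Nr + 1) + t * (Nr ^+ 2 * vv) + t^-1 * (2 * m%:R) +
       2 * m%:R * (vv + 2 * m%:R) + (B + c) * (2 * m%:R) ^+ 2) +
  Nr * g * (31 * Y + 7).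
Proof.
move=> mN t0 B0 hB hV hY hG; pose w := (2 * m)%N.
have Nr0' := ltW Nr0; have c0' := ltW c0.
have wE : w%:R = 2 * m%:R :> R by rewrite natrM.
have wN : w%:R <= Nr by rewrite ler_nat.
have w0 : 0 <= w%:R :> R by [].
pose r := s ^+ 4.
have r0 : 0 <= r by exact: exprn_ge0.
have r1 : r <= 1 by exact: exprn_ile1.
have n1 := setpoly_nonneg R A1 cutoff; have n2 := setpoly_nonneg R A2 cutoff.
have tailD n : (cutoff <= n)%N -> n.+1%:R ^+ 2 * r ^+ n.+1 <= Nr^-1 ^+ 2.
  by move=> hn; apply: sq_radius_tail; exact: leqW.
have ile := inv_sq_le.
have one_le n : 1 <= n.+1%:R :> R by rewrite ler1n.
have tail0 n : (cutoff <= n)%N -> r ^+ n.+1 <= 1 / 2.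
  move=> hn; apply: (@le_trans _ _ (n.+1%:R ^+ 2 * r ^+ n.+1)).
    by rewrite ler_peMl ?exprn_ge0 // exprn_ege1.
  by have := tailD n hn; lra.
have tail1 n : (cutoff <= n)%N -> n.+1%:R * r ^+ n.+1 <= 1.
  move=> hn; apply: (@le_trans _ _ (n.+1%:R ^+ 2 * r ^+ n.+1)).
    by rewrite expr2 -mulrA ler_peMl ?mulr_ge0 ?exprn_ge0.
  by have := tailD n hn; lra.
have vB : deg_bound.+1%:R * `|cum gf_err deg_bound| * r ^+ deg_bound.+1 <= B + c.
  have h := cum_gf_err_le B0 hB (leqnn deg_bound).
  have Bc0 : 0 <= B + c by rewrite addr_ge0.
  apply: (@le_trans _ _ ((B + c) * (deg_bound.+1%:R ^+ 2 * r ^+ deg_bound.+1))).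
    rewrite expr2 !mulrA ler_wpM2r ?exprn_ge0 //.
    by rewrite [X in X <= _]mulrC; apply: ler_wpM2r.
  rewrite ler_piMr //; have := tailD _ cutoff_le_deg; lra.
have dB : cutoff.+1%:R * `|cum (gf1 - gf2) cutoff| * r ^+ cutoff.+1 * w%:R <= 1.
  have hd : `|cum (gf1 - gf2) cutoff| <= cutoff.+1%:R.
    rewrite cum_gf_diff // ler_norml.
    have h1 : (count_upto A1 cutoff)%:R <= cutoff.+1%:R :> R.
      by rewrite ler_nat count_upto_leS.
    have h2 : (count_upto A2 cutoff)%:R <= cutoff.+1%:R :> R.
      by rewrite ler_nat count_upto_leS.
    have h3 : 0 <= (count_upto A1 cutoff)%:R :> R by [].
    have h4 : 0 <= (count_upto A2 cutoff)%:R :> R by [].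
    by apply/andP; split; lra.
  apply: (@le_trans _ _ (cutoff.+1%:R ^+ 2 * r ^+ cutoff.+1 * w%:R)).
    by rewrite ler_wpM2r // ler_wpM2r ?exprn_ge0 // expr2 ler_wpM2l.
  apply: (@le_trans _ _ (Nr^-1 ^+ 2 * Nr)).
    by apply: ler_pM => //; [rewrite mulr_ge0 ?sqr_ge0 ?exprn_ge0|exact: tailD].
  by rewrite expr2 -mulrA mulVf ?lt0r_neq0 // mulr1 invf_le1.
have := @core_inequality _ r gf1 gf2 gf_rest err_sums diff_sums c
  (cum gf_err deg_bound) (cum (gf1 - gf2) cutoff) (B + c) t Nr deg_bound cutoff w r0 r1 c0' t0 Nr0
  gf_rest_nonneg gf_all_abel gf_diff_abel
  (tail0 _ cutoff_le_deg) (tail1 _ cutoff_le_deg) vB dB.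
have hl := @dot_lower_bound _ r gf1 gf2 gf_rest N m w n1 n2 gf_rest_nonneg r0 r1 _.
move/(le_trans (hl _)); rewrite /w leq_pmull // -/w => /(_ isT) => {hl} hl.
set S1 := \sum_(a < N.+1) a%:R * (`[< A1 a >])%:R.
have e1 : \sum_(a < N.+1) a%:R * gf1`_a ^+ 2 = S1.
  apply: eq_bigr => a _; rewrite setpoly_sq coef_poly.
  by rewrite (leq_trans (ltn_ord a)) // ltnS /cutoff -{1}[N]expn1 leq_exp2l.
have S10 : 0 <= S1 by apply: sumr_ge0 => a _; rewrite mulr_ge0.
have cG0 : 0 <= cum gf_rest m by apply: cum_ge0; exact: gf_rest_nonneg.
rewrite e1 (_ : (w - m)%:R = m%:R) in hl; last by rewrite /w mul2n -addnn addnK.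
have hr : 8^-1 ^+ 16 <= r ^+ (2 * (N + w)).
  apply: (@le_trans _ _ (s ^+ (N * 16))).
    have := radius_lower_bound N2 (erefl s); rewrite div1r => h8.
    by rewrite exprM ler_pXn2r ?nnegrE ?exprn_ge0.
  have -> : (N * 16 = 4 * (2 * (N + N)))%N by rewrite addnn -mul2n !mulnA mulnC.
  by rewrite /r -exprM ler_wiXn2l // !leq_mul2l leq_add2l mN !orbT.
have hl' : S1 * cum gf_rest m * m%:R * 8^-1 ^+ 16 <=
    S1 * cum gf_rest m * m%:R * r ^+ (2 * (N + w)).
  by rewrite ler_wpM2l // !mulr_ge0.
apply: (le_trans hl'); apply: (le_trans hl) => {hl hl'}.
have tV : dot r (theta err_sums) (theta err_sums) <= Nr ^+ 2 * vv.
  apply: le_trans (dot_theta_le Nr1 sE err_sums) _; by rewrite ler_wpM2l ?sqr_ge0.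
have tD : dot r (theta diff_sums) (theta diff_sums) <= Nr ^+ 2 * Y.
  apply: le_trans (dot_theta_le Nr1 sE diff_sums) _; by rewrite ler_wpM2l ?sqr_ge0.
have hV' : dot r err_sums err_sums <= vv by apply: le_trans (dot_radius_le Nr1 sE err_sums) hV.
have hD' : dot r diff_sums diff_sums <= Y by apply: le_trans (dot_radius_le Nr1 sE diff_sums) hY.
have hS : dot r (geom R w) (geom R w) <= 2 * m%:R.
  by rewrite -wE; exact: dot_geom_le_size Nr1 sE w.
have hE : dot r (geom R deg_bound.+1) (geom R deg_bound.+1) <= Nr.
  exact: dot_geom_le Nr1 sE _.
have sq_ge0 p : 0 <= dot r p p.
  by apply: sumr_ge0 => i _; rewrite mulr_ge0 -?expr2 ?sqr_ge0 ?exprn_ge0.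
have Y0 : 0 <= Y by apply: le_trans hD'.
have g0 : 0 <= gf_rest.[s ^+ 3].
  rewrite horner_coef; apply: sumr_ge0 => i _.
  by rewrite mulr_ge0 ?exprn_ge0 // gf_rest_nonneg.
have hg1 : gf_rest.[r] <= g by apply: le_trans (horner_radius_le Nr1 sE gf_rest_nonneg) hG.
have hg2 : (theta gf_rest).[r] <= Nr * g.
  by apply: le_trans (horner_theta_le Nr1 sE gf_rest_nonneg) _; rewrite ler_wpM2l.
have gr0 p : nonneg_poly p -> 0 <= p.[r].
  move=> p0; rewrite horner_coef; apply: sumr_ge0 => i _.
  by rewrite mulr_ge0 ?exprn_ge0.
apply: lerD.
  rewrite ler_pM2l // -wE; apply: lerD => //; apply: lerD.
    apply: lerD; last by rewrite ler_wpM2l ?invr_ge0 ?(ltW t0) // wE.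
    apply: lerD; last by rewrite ler_wpM2l ?(ltW t0).
    rewrite ler_wpM2l ?mulr_ge0 ?sqr_ge0 //; lra.
  by rewrite ler_wpM2l //; apply: lerD; rewrite ?wE.
have DD0 := sq_ge0 diff_sums; have tDD0 := sq_ge0 (theta diff_sums).
have k1 : Nr * (8 * dot r diff_sums diff_sums + 2) <= Nr * (8 * Y + 2).
  by rewrite ler_wpM2l //; lra.
have k2 : Nr^-1 * (3 * (4 * dot r (theta diff_sums) (theta diff_sums) +
    w%:R ^+ 2 * dot r diff_sums diff_sums + 1)) <= Nr * (15 * Y + 3).
  apply: (@le_trans _ _ (Nr^-1 * (3 * (4 * (Nr ^+ 2 * Y) + Nr ^+ 2 * Y + Nr ^+ 2)))).
    rewrite ler_wpM2l ?invr_ge0 //.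
    have : w%:R ^+ 2 * dot r diff_sums diff_sums <= Nr ^+ 2 * Y.
      by apply: ler_pM => //; rewrite ?sqr_ge0 // ler_sqr ?nnegrE.
    have : 1 <= Nr ^+ 2 by rewrite exprn_ege1.
    by lra.
  rewrite le_eqVlt; apply/orP; left; apply/eqP; field; exact: lt0r_neq0.
have z0 : 0 <= Nr * (8 * dot r diff_sums diff_sums + 2).
  by rewrite mulr_ge0 //; lra.
have z1 : 0 <= Nr^-1 * (3 * (4 * dot r (theta diff_sums) (theta diff_sums) +
    w%:R ^+ 2 * dot r diff_sums diff_sums + 1)).
  rewrite mulr_ge0 ?invr_ge0 //; have := mulr_ge0 (sqr_ge0 (w%:R : R)) DD0; lra.
have q1 := ler_pM (gr0 _ gf_rest_nonneg) (addr_ge0 z0 z1) hg1 (lerD k1 k2).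
have z2 : 0 <= 8 * dot r diff_sums diff_sums + 2 by lra.
have k3 : 8 * dot r diff_sums diff_sums + 2 <= 8 * Y + 2 by lra.
have q2 := ler_pM (gr0 _ (nonneg_theta gf_rest_nonneg)) z2 hg2 k3.
apply: le_trans (lerD q1 q2) _.
rewrite le_eqVlt; apply/orP; left; apply/eqP; ring.
Qed.
End Radius.

End Polys.
(** * Choice of the parameters *)

Lemma repr_count_lower : exists n0, forall n, (n0 <= n)%N ->
  c / 2 * n%:R <= (repr_count A n)%:R.
Proof.
have c20 : 0 < c / 2 by rewrite divr_gt0.
have [n0 h] := asym c20; exists (maxn n0 1) => n; rewrite geq_max => /andP[hn n1].
have q : n%:R `^ (1 / 4) <= n%:R :> R.
  by rewrite -[X in _ <= X]powRr1 // ler_powR ?ler1n //; lra.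
have := h _ hn; have := ler_wpM2l (ltW c20) q.
have := ler_norm (- ((repr_count A n)%:R - c * n%:R : R)); rewrite normrN; lra.
Qed.

(** With N = (J m)^2, [scale_inequality] compares a lower bound of order
    J^(2 + 2 beta) m^4 with an upper bound (64 c + 27) J^2 m^4, where c and the
    implied constant of the lower bound do not depend on J.  So J is fixed
    first; then the precisions delta and eta, in terms of J; then m is taken
    large enough for the terms of lower order. *)
Lemma asymptotic_absurd : False.
Proof.
have c0' := ltW c0.
have [kap kap0 [n1 hS]] := sum_elements.
have [n2 hlow] := lower.
have [n3 hlow2] := count2_lower b0 b1 al0 al1 diff lo0 hi0 lower.
have [B B0 hB] := repr_count_bound.
have [n4 hR] := repr_count_lower.
have lo20 : 0 < lo / 2 by rewrite divr_gt0.
pose CG := B * 8 ^+ 6 / (lo * (lo / 2)).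
have CG0 : 0 <= CG by rewrite divr_ge0 ?mulr_ge0 ?exprn_ge0 // ltW.
pose hi2 := hi + `|C|.
have hi20 : 0 < hi2 by have := hi0; have := normr_ge0 C; rewrite /hi2; lra.
pose kq := c / 2 / (hi * hi2).
have kq0 : 0 < kq by rewrite !divr_gt0 ?mulr_gt0.
pose kappa := kap * kq * 8^-1 ^+ 16.
have kappa0 : 0 < kappa.
  by apply: mulr_gt0; [exact: mulr_gt0 | rewrite exprn_gt0 // invr_gt0].
have bb0 : 0 < 2 * beta by exact: mulr_gt0.
have [J0 hJ0] := @powR_unbounded R (2 * beta) ((64 * c + 27) / kappa) bb0.
pose J := maxn J0 1; pose j : R := J%:R.
have J1 : (1 <= J)%N by rewrite leq_max orbT.
have j1 : 1 <= j by rewrite ler1n.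
have j0 : 0 < j by exact: lt_le_trans j1.
have hJ : 64 * c + 27 <= kappa * j `^ (2 * beta).
  by rewrite [X in _ <= X]mulrC -ler_pdivrMr //; exact: hJ0 J (leq_maxl _ _).
pose delta := j^-1 ^+ 7.
have delta0 : 0 < delta by rewrite exprn_gt0 // invr_gt0.
pose e := Num.min 1 (delta / 2).
have e0 : 0 < e by rewrite lt_min ltr01 divr_gt0.
have ed : 2 * e ^+ 2 <= delta.
  have h1 : e <= 1 by rewrite ge_min lexx.
  have h2 : e <= delta / 2 by rewrite ge_min lexx orbT.
  have : e ^+ 2 <= e by rewrite expr2 ler_piMr // ltW.
  by lra.
have [K K0 hK] := repr_count_error e0.
pose K1 := 2 * K ^+ 2 + 4 * (B + c) ^+ 2.
have K10 : 0 <= K1 by rewrite addr_ge0 // mulr_ge0 ?sqr_ge0.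
pose eta := (93 * (CG + 1) * j ^+ 4)^-1.
have CG10 : 0 < CG + 1 by rewrite ltr_wpDl.
have j40 : 0 < j ^+ 4 by rewrite exprn_gt0.
have eta0 : 0 < eta by rewrite invr_gt0 !mulr_gt0.
have [K' K'0 hK'] := sum_sq_diff_le b0 b1 al0 al1 close diff lo0 hi0 lower upper eta0.
pose CP := CG * (93 * K' + 7).
have CP0 : 0 <= CP by rewrite mulr_ge0 // addr_ge0 // mulr_ge0.
have [n5 hN5] := @powR_unbounded R (2 * beta) (j ^+ 4 * CP) bb0.
have [M0 hM0] : exists M0, forall n, (M0 <= n)%N ->
    4 * K1 * j ^+ 6 + 8 * K1 * j ^+ 2 + 16 + 16 * (B + c) <= n%:R.
  have [M0 h] := @powR_unbounded R 1
    (4 * K1 * j ^+ 6 + 8 * K1 * j ^+ 2 + 16 + 16 * (B + c)) ltr01.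
  by exists M0 => n /h; rewrite powRr1.
have [m [[m1 m2 m3] [m4 m5 m6] m7]] : exists m,
  [/\ [/\ (n1 <= m)%N, (n2 <= m)%N & (n3 <= m)%N],
    [/\ (n4 <= m)%N, (n5 <= m)%N & (M0 <= m)%N] & (2 <= m)%N].
  exists (n1 + n2 + n3 + n4 + n5 + M0 + 2)%N; clear; do !split; lia.
pose N := ((J * m) ^ 2)%N; pose M : R := m%:R.
have mJ : (m <= J * m)%N by rewrite leq_pmull.
have m0 : (0 < m)%N by apply: leq_trans m7.
have mN : (m <= N)%N.
  by apply: (leq_trans mJ); rewrite /N -{1}[(J * m)%N]expn1 leq_pexp2l // muln_gt0 J1.
have N2m : (2 * m <= N)%N.
  apply: (@leq_trans (m ^ 2)); first by rewrite expnS expn1 leq_mul2r m7 orbT.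
  by rewrite leq_exp2r.
have N2 : (2 <= N)%N by exact: leq_trans mN.
have mcut : (m <= cutoff N)%N.
  by apply: (leq_trans mN); rewrite /cutoff -{1}[N]expn1 leq_pexp2l // (leq_trans _ N2).
have NE : N%:R = (j * M) ^+ 2 :> R by rewrite natrX natrM.
have M1 : 1 <= M by rewrite ler1n.
have M0' : 0 < M by exact: lt_le_trans M1.
have jM0 : 0 <= j * M by rewrite mulr_ge0 // ltW.
have sqN : Num.sqrt N%:R = j * M :> R by rewrite NE sqrtr_sqr ger0_norm.
have jnz : j != 0 by exact: lt0r_neq0.
have Mnz : M != 0 by exact: lt0r_neq0.
pose u := N%:R `^ (2 * beta) : R.
have u0 : 0 < u by rewrite powR_gt0 // ltr0n (leq_trans _ N2).
have hu : j ^+ 4 * CP <= u by apply: hN5; exact: leq_trans mN.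
(* The square root of N is j M, so this is (delta sqrt N + K1) N. *)
pose vv := (delta * (j * M) + K1) * (j * M) ^+ 2.
have hvv : dot (radius N ^+ 3) (err_sums N) (err_sums N) <= vv.
  apply: le_trans (err_sums_bound N2 B0 (ltW e0) K0 hB hK) _.
  by rewrite sqN NE /vv ler_wpM2r ?sqr_ge0 // lerD2r ler_wpM2r.
have hY := diff_sums_bound N2 (ltW eta0) K'0 hK'.
have hG := gf_rest_bound N2 B0 lo0 lo20 hB (hlow _ (leq_trans m2 mN))
  (hlow2 _ (leq_trans m3 mN)).
(* The weight t = M^(-3) balances |theta V|^2, of mean about delta N^(7/2),
   against the square of the window, of mean at most 2 M. *)
have t0 : 0 < M^-1 ^+ 3 by rewrite exprn_gt0 // invr_gt0.
have := scale_inequality N2 N2m t0 B0 hB hvv hY hG.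
rewrite -/CG -/u.
have jb : N%:R `^ beta = j `^ (2 * beta) * M `^ (2 * beta) :> R.
  rewrite NE -powR_mulrn // -powRrM powRM ?(ltW j0) ?(ltW M0') //.
have Mb0 : 0 < M `^ (2 * beta) by rewrite powR_gt0.
have cG : kq * (M / M `^ (2 * beta)) <= cum (gf_rest N) m.
  have h1 := cum_gf_rest_lower mcut; have h2 := hR _ m4.
  have h3 : (count_upto A1 m)%:R * (count_upto A2 m)%:R <= hi * hi2 * M `^ (2 * beta).
    have -> : hi * hi2 * M `^ (2 * beta) = hi * M `^ beta * (hi2 * M `^ beta).
      have -> : M `^ (2 * beta) = M `^ beta * M `^ beta.
        by rewrite -powRD ?Mnz ?implybT //; congr (_ `^ _); ring.
      by ring.
    by apply: ler_pM => //; [exact: upper|exact: count2_upper].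
  have PG0 : 0 <= cum (gf_rest N) m by apply: cum_ge0; exact: gf_rest_nonneg.
  have h4 := le_trans h2 (le_trans h1 (ler_wpM2r PG0 h3)).
  have -> : kq * (M / M `^ (2 * beta)) = c / 2 * M / (hi * hi2 * M `^ (2 * beta)).
    by rewrite /kq; field; rewrite !lt0r_neq0.
  rewrite ler_pdivrMr; last exact: mulr_gt0 (mulr_gt0 hi0 hi20) Mb0.
  by rewrite [X in _ <= X]mulrC.
have := hS _ (leq_trans m1 mN); set S1 := \sum_(a < N.+1) _ => hS1.
have lb : kappa * j `^ (2 * beta) * j ^+ 2 * M ^+ 4 <=
    S1 * cum (gf_rest N) m * m%:R * 8^-1 ^+ 16.
  have -> : kappa * j `^ (2 * beta) * j ^+ 2 * M ^+ 4 =
     kap * (N%:R * N%:R `^ beta) * (kq * (M / M `^ (2 * beta))) * M * 8^-1 ^+ 16.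
    by rewrite jb NE /kappa; field; rewrite lt0r_neq0.
  rewrite ler_wpM2r ?exprn_ge0 ?invr_ge0 // ler_wpM2r //.
  apply: ler_pM => //.
    exact: mulr_ge0 (ltW kap0) (mulr_ge0 (ler0n _ _) (powR_ge0 _ _)).
  exact: mulr_ge0 (ltW kq0) (divr_ge0 (ltW M0') (ltW Mb0)).
move/(le_trans lb); apply/negP; rewrite -ltNge {lb hS1 cG S1 hG hY hvv}.
have hM := hM0 _ m6; rewrite -/M in hM *.
have Bc0 : 0 <= B + c by rewrite addr_ge0.
have p1 : 0 <= 4 * K1 * j ^+ 6 by rewrite !mulr_ge0 ?exprn_ge0 // ltW.
have p2 : 0 <= 8 * K1 * j ^+ 2 by rewrite !mulr_ge0 ?exprn_ge0 // ltW.
have dj : delta * j ^+ 7 = 1 by rewrite /delta -exprMn mulVf // expr1n.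
have M30 : 0 <= M ^+ 3 by rewrite exprn_ge0 // ltW.
have M4 : M ^+ 4 = M * M ^+ 3 by rewrite exprS.
have M23 : M ^+ 2 <= M ^+ 3 by rewrite [M ^+ 3]exprS ler_peMl ?exprn_ge0 // ltW.
have a1 : 4 * (c * (2 * M) ^+ 2 * (3 * N%:R + 1)) <= 64 * c * j ^+ 2 * M ^+ 4.
  have -> : 64 * c * j ^+ 2 * M ^+ 4 = 4 * (c * (2 * M) ^+ 2 * (4 * N%:R)).
    by rewrite NE; ring.
  rewrite ler_wpM2l // ler_wpM2l ?mulr_ge0 ?sqr_ge0 //.
  have : 1 <= N%:R :> R by rewrite ler1n (leq_trans _ N2).
  lra.
have a2 : 4 * (M^-1 ^+ 3 * (N%:R ^+ 2 * vv)) = 4 * M ^+ 4 + 4 * K1 * j ^+ 6 * M ^+ 3.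
  transitivity (4 * (delta * j ^+ 7) * M ^+ 4 + 4 * K1 * j ^+ 6 * M ^+ 3).
    by rewrite NE /vv; field.
  by rewrite dj mulr1.
have a3 : 4 * ((M^-1 ^+ 3)^-1 * (2 * M)) = 8 * M ^+ 4 by field.
have a4 : 4 * (2 * M * (vv + 2 * M)) <=
    8 * M ^+ 4 + 8 * K1 * j ^+ 2 * M ^+ 3 + 16 * M ^+ 3.
  have dj3 : delta * j ^+ 3 <= 1.
    by rewrite -[X in _ <= X]dj ler_wpM2l ?(ltW delta0) // ler_weXn2l.
  have -> : 4 * (2 * M * (vv + 2 * M)) =
      8 * (delta * j ^+ 3) * M ^+ 4 + 8 * K1 * j ^+ 2 * M ^+ 3 + 16 * M ^+ 2.
    by rewrite /vv; ring.
  have M40 : 0 <= M ^+ 4 by rewrite exprn_ge0 // ltW.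
  by have := ler_wpM2r M40 dj3; lra.
have a5 : 4 * ((B + c) * (2 * M) ^+ 2) <= 16 * (B + c) * M ^+ 3.
  have -> : 4 * ((B + c) * (2 * M) ^+ 2) = 16 * (B + c) * M ^+ 2 by ring.
  by rewrite ler_wpM2l // mulr_ge0.
have a6 : N%:R * (CG * (N%:R / u)) * (31 * (3 * (K' + eta * u)) + 7) <= 2 * M ^+ 4.
  have -> : N%:R * (CG * (N%:R / u)) * (31 * (3 * (K' + eta * u)) + 7) =
     j ^+ 4 * CP / u * M ^+ 4 + 93 * CG * eta * j ^+ 4 * M ^+ 4.
    by rewrite NE /CP; field; rewrite lt0r_neq0.
  have M40 : 0 <= M ^+ 4 by rewrite exprn_ge0 // ltW.
  have q1 : j ^+ 4 * CP / u <= 1 by rewrite ler_pdivrMr // mul1r.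
  have q2 : 93 * CG * eta * j ^+ 4 <= 1.
    have -> : 93 * CG * eta * j ^+ 4 = CG / (CG + 1).
      by rewrite /eta; field; rewrite !lt0r_neq0.
    by rewrite ler_pdivrMr // mul1r lerDl.
  by have := ler_wpM2r M40 q1; have := ler_wpM2r M40 q2; lra.
have b6 : (4 * K1 * j ^+ 6 + 8 * K1 * j ^+ 2 + 16 + 16 * (B + c)) * M ^+ 3 <= M ^+ 4.
  by rewrite M4 ler_wpM2r.
have M40 : 0 < M ^+ 4 by rewrite exprn_gt0.
have fin : (64 * c + 27) * (j ^+ 2 * M ^+ 4) <=
    kappa * j `^ (2 * beta) * j ^+ 2 * M ^+ 4.
  rewrite -[X in _ <= X]mulrA ler_wpM2r // mulr_ge0 ?exprn_ge0 // ltW //.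
apply: lt_le_trans fin.
have jm : M ^+ 4 <= j ^+ 2 * M ^+ 4 by rewrite ler_peMl ?exprn_ege1 // ltW.
lra.
Qed.

End Scale.

(** * From asymptotic notation to explicit bounds *)

Lemma near_infty_exists (P : nat -> Prop) :
  (\forall n \near \oo, P n) -> exists n0, forall n, (n0 <= n)%N -> P n.
Proof. by move=> [n0 _ h]; exists n0 => n /h. Qed.

Lemma upper_everywhere (R : realType) (b hi : R) (A0 : set nat) : 0 < b ->
  (exists n0, forall n, (n0 <= n)%N -> (count_upto A0 n)%:R <= hi * n%:R `^ b) ->
  exists2 hi' : R, 0 < hi' &
    forall n, (1 <= n)%N -> (count_upto A0 n)%:R <= hi' * n%:R `^ b.
Proof.
move=> b0 [n0 h]; exists (`|hi| + n0.+1%:R); first by rewrite ltr_wpDl.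
move=> n n1; have p1 : 1 <= n%:R `^ b :> R.
  by rewrite -[X in X <= _](powRr0 (n%:R : R)) ler_powR ?ler1n ?ltW.
have p0 : 0 <= n%:R `^ b :> R by exact: powR_ge0.
rewrite mulrDl; case: (leqP n0 n) => hn.
  apply: le_trans (h _ hn) _; apply: ler_wpDr; first by rewrite mulr_ge0.
  by rewrite ler_wpM2r // ler_norm.
apply: ler_wpDl; first by rewrite mulr_ge0.
apply: (@le_trans _ _ n0.+1%:R); last by rewrite ler_peMr.
by rewrite ler_nat (leq_trans (count_upto_leS _ _)) // ltnS ltnW.
Qed.

Unset Implicit Arguments.
Set Strict Implicit.

Theorem theorem2 (R : realType) (alpha beta : R) (k : nat)
    (hk : (3 <= k)%N) (A : 'I_k -> set nat) :
  0 < beta -> beta <= 1 / 2 -> 0 <= alpha -> alpha <= beta / 2 ->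
  (forall j : 'I_k, A j !=set0) ->
  let A1 := A (idx1 hk) in
  let A2 := A (idx2 hk) in
  (fun i : nat => (nth_elt A1 i)%:R - (nth_elt A2 i)%:R : R)
    =o_\oo (fun i : nat => (nth_elt A1 i)%:R `^ (beta - alpha)) ->
  (exists C : R, forall n : nat, (1 <= n)%N ->
    `|(count_upto A1 n)%:R - (count_upto A2 n)%:R| <= C * n%:R `^ alpha) ->
  (fun n : nat => (count_upto A1 n)%:R : R)
    =Theta_\oo (fun n : nat => n%:R `^ beta) ->
  ~ exists2 c : R, 0 < c &
      (fun n : nat => (repr_count A n)%:R : R)
        = (fun n : nat => c * n%:R) +o_\oo (fun n : nat => n%:R `^ (1 / 4)).
Proof.
move=> b0 b1 al0 al1 _ A1 A2 h1 [C h2] h3 [c c0 h4].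
have close (eta : R) : 0 < eta -> exists i0, forall i, (i0 <= i)%N ->
    `|(nth_elt A1 i)%:R - (nth_elt A2 i)%:R| <=
    eta * (nth_elt A1 i)%:R `^ (beta - alpha).
  move=> eta0; move/eqoP : h1 => /(_ _ eta0) /near_infty_exists[i0 h].
  by exists i0 => i /h; rewrite [X in _ <= _ * X]ger0_norm // powR_ge0.
have asym (eps : R) : 0 < eps -> exists n0, forall n, (n0 <= n)%N ->
    `|(repr_count A n)%:R - c * n%:R| <= eps * n%:R `^ (1 / 4).
  move=> eps0; move/eqaddoP : h4 => /(_ _ eps0) /near_infty_exists[n0 h].
  by exists n0 => n /h; rewrite [X in _ <= _ * X]ger0_norm // powR_ge0.
move: h3; rewrite eqThetaE qualifE => /asboolP[[lo hi] /= /andP[lo0 hi0]].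
move=> /near_infty_exists[n0 h].
have lower : exists n0, forall n, (n0 <= n)%N ->
    lo * n%:R `^ beta <= (count_upto A1 n)%:R.
  by exists n0 => n /h[]; rewrite !ger0_norm ?powR_ge0.
have upper : exists n0, forall n, (n0 <= n)%N ->
    (count_upto A1 n)%:R <= hi * n%:R `^ beta.
  by exists n0 => n /h[_]; rewrite !ger0_norm ?powR_ge0.
have [hi' hi'0 upper'] := @upper_everywhere R beta hi A1 b0 upper.
exact: (asymptotic_absurd b0 b1 al0 al1 close h2 lo0 hi'0 lower upper' c0 asym).
Qed.
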